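(* Let $k$ be a field and let $E$ and $F$ be finite graphs with no sinks. Let $M$ be a $kE^0$--$kF^0$-bimodule and let $\sigma: kE^1\otimes_{kE^0}M\to M\otimes_{kF^0}kF^1$ be a $kE^0$--$kF^0$-bimodule isomorphism. The right $L_k(F)$-module $M\otimes_{kF^0}L_k(F)$ admits a left $L_k(E)$-action which makes $M\otimes_{kF^0}L_k(F)$ into an $L_k(E)$--$L_k(F)$-bimodule. The left $L_k(E)$-action is determined by the following relations: (1) If $v\in E^0$, $m\in M$, and $S\in L_k(F)$, then $v\cdot(m\otimes S)=vm\otimes S$. (2) If $e\in E^1$, $m\in M$, and $S\in L_k(F)$ with $\sigma(e\otimes m)=\sum_{i=1}^n m_i\otimes y_i$ for $m_1,\dots,m_n\in M$ and $y_1,\dots,y_n\in kF^1$, then $$e\cdot(m\otimes S)=\sum_{i=1}^n m_i\otimes y_iS.$$ (3) If $e\in E^1$, $m\in M$, and $S\in L_k(F)$, and if for each $f\in F^1$ we have $\sigma^{-1}(m\otimes f)=\sum_{i=1}^{n_f}y_i^f\otimes m_i^f$ for $y_1^f,\dots,y_{n_f}^f\in kE^1$ and $m_1^f,\dots,m_{n_f}^f\in M$, then $$e^*\cdot(m\otimes S)=\sum_{f\in F^1}\sum_{i=1}^{n_f}(e^*y_i^f)m_i^f\otimes f^*S.$$ (In particular, if $S=g\in F^1$ is an edge and $\sigma^{-1}(m\otimes g)=\sum_{i=1}^{n_g}y_i^g\otimes m_i^g$, then $e^*\cdot(m\otimes g)=\sum_{i=1}^{n_g}(e^*y_i^g)m_i^g\otimes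 r(g)$.) Moreover, if we define, for $n\in\mathbb{Z}$, $$Y_n:=\operatorname{span}_k\{x\otimes S : x\in M\text{ and }S\in L_k(F)_n\},$$ then the $k$-subspaces $\{Y_n : n\in\mathbb{Z}\}$ provide a $\mathbb{Z}$-grading that makes $M\otimes_{kF^0}L_k(F)$ a $\mathbb{Z}$-graded $L_k(E)$--$L_k(F)$-bimodule.
   Context: A (directed) graph $E=(E^0,E^1,s,r)$ consists of a vertex set $E^0$, an edge set $E^1$, and source and range maps $s,r:E^1\to E^0$. It is finite if $E^0$ and $E^1$ are finite; a vertex $v$ is a sink if $s^{-1}(v)=\emptyset$. $kE^0$ is the $k$-algebra with $k$-basis $E^0$ and product $vw=\delta_{v,w}v$. $kE^1$ is the $k$-vector space with basis $E^1$, a $kE^0$--$kE^0$-bimodule via $v\cdot e=\delta_{v,s(e)}e$ and $e\cdot w=\delta_{w,r(e)}e$. Bimodules over $k$-algebras are unital, and the left and right actions of $k$ agree. The Leavitt path algebra $L_k(E)$ of a finite graph with no sinks is the $k$-algebra generated by $\{v: v\in E^0\}\cup\{e,e^*: e\in E^1\}$ subject to: $vu=\delta_{v,u}v$; $s(e)e=er(e)=e$; $r(e)e^*=e^*s(e)=e^*$; $e^*e'=\delta_{e,e'}r(e)$; and $v=\sum_{e\in s^{-1}(v)}ee^*$ for every $v\in E^0$. It is unital with $1=\sum_{v\in E^0}v$, and $kE^0$ (as a subalgebra) and $kE^1$ embed in it in the natural way; $L_k(F)$ is thereby a $kF^0$--$L_k(F)$-bimodule. For $e\in E^1$ and $y\in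 kE^1$ the element $e^*y\in L_k(E)$ lies in $kE^0$. $L_k(E)$ is $\mathbb{Z}$-graded with $n$th component $L_k(E)_n$ spanned by the elements $\alpha\beta^*$ where $\alpha,\beta$ are paths in $E$ with $\ell(\alpha)-\ell(\beta)=n$ (vertices being paths of length $0$). For $\mathbb{Z}$-graded rings $R,S$, an $R$--$S$-bimodule $Y$ is $\mathbb{Z}$-graded by subgroups $Y_n$ if $Y=\bigoplus_{n\in\mathbb{Z}}Y_n$ and $R_aY_n\subseteq Y_{n+a}$, $Y_nS_b\subseteq Y_{n+b}$ for all $a,b,n$. *)

(* Defs.v *)
From HB Require Import structures.
From mathcomp Require Import all_boot all_order all_algebra.
From mathcomp Require Import boolp.

Set Implicit Arguments.
Unset Strict Implicit.
Unset Printing Implicit Defensive.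

Import GRing.Theory.
Local Open Scope ring_scope.
Local Open Scope quotient_scope.

(* Unital associative k-algebras in which 1 = 0 is allowed, given by the       *)
(* structural map c |-> c 1 from k to the center. The algType of the library  *)
(* excludes the zero algebra, which is kE^0 (and L_k(E)) when the graph E has *)
(* no vertex, and its hierarchy admits no common parent of pzRingType and     *)
(* lmodType.                                                                  *)
HB.mixin Record isKAlgebra (k : pzRingType) A of GRing.PzRing A := {
  kmap : {rmorphism k -> A};
  kmap_central : forall (c : k) (x : A), kmap c * x = x * kmap c
}.
#[short(type="kAlgType")]
HB.structure Definition KAlgebra (k : pzRingType) :=
  {A of GRing.PzRing A & isKAlgebra k A}.
Arguments kmap {k} s.

(* k-modules given by generators and relations: linear expressions in the     *)
(* generators, modulo the least k-linear congruence containing the relations. *)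

Inductive mterm (k : pzRingType) (G : Type) : Type :=
| MGen of G
| MZero
| MAdd of mterm k G & mterm k G
| MScale of k & mterm k G.
Arguments MGen {k G}.
Arguments MZero {k G}.

HB.instance Definition _ (k : pzRingType) (G : Type) := gen_eqMixin (mterm k G).
HB.instance Definition _ (k : pzRingType) (G : Type) :=
  gen_choiceMixin (mterm k G).

Inductive mcong (k : pzRingType) (G : Type) (r : mterm k G -> mterm k G -> Prop) :
  mterm k G -> mterm k G -> Prop :=
| mcong_rel t u : r t u -> mcong r t u
| mcong_refl t : mcong r t t
| mcong_sym t u : mcong r t u -> mcong r u t
| mcong_trans u t w : mcong r t u -> mcong r u w -> mcong r t w
| mcong_add t t' u u' :
    mcong r t t' -> mcong r u u' -> mcong r (MAdd t u) (MAdd t' u')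
| mcong_scale c t t' : mcong r t t' -> mcong r (MScale c t) (MScale c t')
| mcong_addA t u w : mcong r (MAdd t (MAdd u w)) (MAdd (MAdd t u) w)
| mcong_addC t u : mcong r (MAdd t u) (MAdd u t)
| mcong_add0 t : mcong r (MAdd MZero t) t
| mcong_scaleA c d t : mcong r (MScale c (MScale d t)) (MScale (c * d) t)
| mcong_scale0 t : mcong r (MScale 0 t) MZero
| mcong_scale1 t : mcong r (MScale 1 t) t
| mcong_scaleDr c t u :
    mcong r (MScale c (MAdd t u)) (MAdd (MScale c t) (MScale c u))
| mcong_scaleDl c d t :
    mcong r (MScale (c + d) t) (MAdd (MScale c t) (MScale d t)).

Section PresentedModule.
Variables (k : pzRingType) (G : Type) (r : mterm k G -> mterm k G -> Prop).

Definition mcongb (t u : mterm k G) : bool := `[< mcong r t u >].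

Lemma mcongb_refl : reflexive mcongb.
Proof. by move=> t; apply/asboolP; exact: mcong_refl. Qed.
Lemma mcongb_sym : symmetric mcongb.
Proof. by move=> t u; apply/asboolP/asboolP; exact: mcong_sym. Qed.
Lemma mcongb_trans : transitive mcongb.
Proof.
by move=> u t w /asboolP tu /asboolP uw; apply/asboolP; exact: mcong_trans tu uw.
Qed.
Canonical mcong_equiv := EquivRel mcongb mcongb_refl mcongb_sym mcongb_trans.

Definition mpres := {eq_quot mcong_equiv}.
HB.instance Definition _ := Choice.on mpres.

Definition mpi (t : mterm k G) : mpres := \pi_{eq_quot mcong_equiv} t.

Lemma mpiP t u : mpi t = mpi u <-> mcong r t u.
Proof.
split=> [/eqmodP/asboolP //|tu]; apply/eqmodP; exact/asboolP.
Qed.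

Lemma mpi_surj (x : mpres) : exists t, x = mpi t.
Proof. by exists (repr x); rewrite /mpi reprK. Qed.

Lemma mrepr t : mcong r (repr (mpi t)) t.
Proof. by apply/mpiP; rewrite /mpi reprK. Qed.

Definition mpres_add (x y : mpres) : mpres := mpi (MAdd (repr x) (repr y)).
Definition mpres_scale (c : k) (x : mpres) : mpres := mpi (MScale c (repr x)).
Definition mpres_zero : mpres := mpi MZero.
Definition mpres_opp (x : mpres) : mpres := mpres_scale (-1) x.

Lemma mpiD t u : mpres_add (mpi t) (mpi u) = mpi (MAdd t u).
Proof. by apply/mpiP; apply: mcong_add; exact: mrepr. Qed.
Lemma mpiZ c t : mpres_scale c (mpi t) = mpi (MScale c t).
Proof. by apply/mpiP; apply: mcong_scale; exact: mrepr. Qed.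

Fact mpres_addA : associative mpres_add.
Proof.
move=> x y z; have [t ->] := mpi_surj x; have [u ->] := mpi_surj y.
by have [w ->] := mpi_surj z; rewrite !mpiD; apply/mpiP; exact: mcong_addA.
Qed.
Fact mpres_addC : commutative mpres_add.
Proof.
move=> x y; have [t ->] := mpi_surj x; have [u ->] := mpi_surj y.
by rewrite !mpiD; apply/mpiP; exact: mcong_addC.
Qed.
Fact mpres_add0 : left_id mpres_zero mpres_add.
Proof.
by move=> x; have [t ->] := mpi_surj x; rewrite mpiD; apply/mpiP/mcong_add0.
Qed.
Fact mpres_addN : left_inverse mpres_zero mpres_opp mpres_add.
Proof.
move=> x; have [t ->] := mpi_surj x.
rewrite /mpres_opp mpiZ mpiD; apply/mpiP.
apply: (mcong_trans (u := MAdd (MScale (-1) t) (MScale 1 t))).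
  by apply: mcong_add; [exact: mcong_refl|apply/mcong_sym/mcong_scale1].
apply: (mcong_trans (u := MScale (-1 + 1) t)).
  exact/mcong_sym/mcong_scaleDl.
by rewrite addNr; exact: mcong_scale0.
Qed.
HB.instance Definition _ :=
  GRing.isZmodule.Build mpres mpres_addA mpres_addC mpres_add0 mpres_addN.

Fact mpres_scaleA a b (x : mpres) :
  mpres_scale a (mpres_scale b x) = mpres_scale (a * b) x.
Proof.
by have [t ->] := mpi_surj x; rewrite !mpiZ; apply/mpiP/mcong_scaleA.
Qed.
Fact mpres_scale1 : left_id 1 mpres_scale.
Proof.
by move=> x; have [t ->] := mpi_surj x; rewrite mpiZ; apply/mpiP/mcong_scale1.
Qed.
Fact mpres_scaleDr : right_distributive mpres_scale +%R.
Proof.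
move=> c x y; have [t ->] := mpi_surj x; have [u ->] := mpi_surj y.
rewrite /GRing.add /= mpiD !mpiZ mpiD; exact/mpiP/mcong_scaleDr.
Qed.
Fact mpres_scaleDl (x : mpres) : {morph mpres_scale^~ x : a b / a + b}.
Proof.
move=> c d; have [t ->] := mpi_surj x.
rewrite [RHS]/GRing.add /= !mpiZ mpiD; exact/mpiP/mcong_scaleDl.
Qed.
HB.instance Definition _ := GRing.Zmodule_isLmodule.Build k mpres
  mpres_scaleA mpres_scale1 mpres_scaleDr mpres_scaleDl.

Definition mgen (g : G) : mpres := mpi (MGen g).

Lemma mpi0 : mpi MZero = 0. Proof. by []. Qed.
Lemma mpi_add t u : mpi (MAdd t u) = mpi t + mpi u.
Proof. by rewrite -mpiD. Qed.
Lemma mpi_scale c t : mpi (MScale c t) = c *: mpi t.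
Proof. by rewrite -mpiZ. Qed.

Lemma mpres_ind (P : mpres -> Prop) :
  P 0 -> (forall x y, P x -> P y -> P (x + y)) ->
  (forall c x, P x -> P (c *: x)) -> (forall g, P (mgen g)) -> forall x, P x.
Proof.
move=> P0 PD PZ Pg x; have [t ->] := mpi_surj x.
elim: t => [g||t IHt u IHu|c t IHt]; [exact: Pg|exact: P0| |].
  by rewrite mpi_add; exact: PD.
by rewrite mpi_scale; exact: PZ.
Qed.

Fixpoint mtermE (V : lmodType k) (f : G -> V) (t : mterm k G) : V :=
  match t with
  | MGen g => f g
  | MZero => 0
  | MAdd t u => mtermE f t + mtermE f u
  | MScale c t => c *: mtermE f t
  end.

(* The linear map out of the presented module sending the generator g to f g; *)
(* mliftP shows that it is what it should be when f satisfies the relations.  *)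
Definition mlift (V : lmodType k) (f : G -> V) (x : mpres) : V :=
  mtermE f (repr x).

Section Lift.
Variables (V : lmodType k) (f : G -> V).
Hypothesis f_rel : forall t u, r t u -> mtermE f t = mtermE f u.

Lemma mtermE_cong t u : mcong r t u -> mtermE f t = mtermE f u.
Proof.
elim=> {t u} //=.
- by move=> u t w _ -> _ ->.
- by move=> t t' u u' _ -> _ ->.
- by move=> c t t' _ ->.
- by move=> t u w; rewrite addrA.
- by move=> t u; rewrite addrC.
- by move=> t; rewrite add0r.
- by move=> c d t; rewrite scalerA.
- by move=> t; rewrite scale0r.
- by move=> t; rewrite scale1r.
- by move=> c t u; rewrite scalerDr.
- by move=> c d t; rewrite scalerDl.
Qed.

Lemma mlift_pi t : mlift f (mpi t) = mtermE f t.
Proof. exact: mtermE_cong (mrepr t). Qed.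

Lemma mliftP : linear (mlift f) /\ forall g, mlift f (mgen g) = f g.
Proof.
split=> [c x y|g]; last exact: mlift_pi.
have [t ->] := mpi_surj x; have [u ->] := mpi_surj y.
by rewrite -mpi_scale -mpi_add !mlift_pi.
Qed.
End Lift.

End PresentedModule.

(* The last clauses say that k acts through A, resp. B, as it acts on V; so   *)
(* the left and right actions of k on a bimodule agree.                       *)
Definition is_lmod (k : fieldType) (A : kAlgType k) (V : lmodType k)
    (la : A -> V -> V) : Prop :=
  [/\ forall x, la 1 x = x,
      forall a b x, la (a * b) x = la a (la b x),
      forall a b x, la (a + b) x = la a x + la b x,
      forall a, linear (la a) &
      forall c x, la (kmap A c) x = c *: x].

Definition is_rmod (k : fieldType) (B : kAlgType k) (V : lmodType k)
    (ra : V -> B -> V) : Prop :=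
  [/\ forall x, ra x 1 = x,
      forall x a b, ra x (a * b) = ra (ra x a) b,
      forall x a b, ra x (a + b) = ra x a + ra x b,
      forall b, linear (ra^~ b) &
      forall c x, ra x (kmap B c) = c *: x].

Definition is_bimod (k : fieldType) (A B : kAlgType k) (V : lmodType k)
    (la : A -> V -> V) (ra : V -> B -> V) : Prop :=
  [/\ is_lmod la, is_rmod ra & forall a x b, la a (ra x b) = ra (la a x) b].

Record bimod (k : fieldType) (A B : kAlgType k) := Bimod {
  bimod_space :> lmodType k;
  lact : A -> bimod_space -> bimod_space;
  ract : bimod_space -> B -> bimod_space;
  bimodP : is_bimod lact ract
}.
Arguments lact {k A B} b.
Arguments ract {k A B} b.

Record bimod_iso (k : fieldType) (A B : kAlgType k) (X Y : bimod A B) := BimodIso {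
  iso_map :> X -> Y;
  iso_inv : Y -> X;
  iso_linear : linear iso_map;
  iso_lact : forall a x, iso_map (lact X a x) = lact Y a (iso_map x);
  iso_ract : forall x b, iso_map (ract X x b) = ract Y (iso_map x) b;
  iso_mapK : cancel iso_map iso_inv;
  iso_invK : cancel iso_inv iso_map
}.

Section Tensor.
Variables (k : fieldType) (A B C : kAlgType k) (X : bimod A B) (Y : bimod B C).

Inductive tensor_rel : mterm k (X * Y) -> mterm k (X * Y) -> Prop :=
| tensor_linl c x x' y : tensor_rel (MGen (c *: x + x', y))
    (MAdd (MScale c (MGen (x, y))) (MGen (x', y)))
| tensor_linr c x y y' : tensor_rel (MGen (x, c *: y + y'))
    (MAdd (MScale c (MGen (x, y))) (MGen (x, y')))
| tensor_bal x b y :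
    tensor_rel (MGen (ract X x b, y)) (MGen (x, lact Y b y)).

Definition tensor_space : lmodType k := mpres tensor_rel.

Definition tensor_pure (x : X) (y : Y) : tensor_space := mgen tensor_rel (x, y).

Lemma tensor_pure_linl y : linear (tensor_pure^~ y).
Proof.
move=> c x x'; rewrite /tensor_pure /mgen -mpi_scale -mpi_add.
by apply/mpiP/mcong_rel; exact: tensor_linl.
Qed.
Lemma tensor_pure_linr x : linear (tensor_pure x).
Proof.
move=> c y y'; rewrite /tensor_pure /mgen -mpi_scale -mpi_add.
by apply/mpiP/mcong_rel; exact: tensor_linr.
Qed.
Lemma tensor_pure_bal x b y :
  tensor_pure (ract X x b) y = tensor_pure x (lact Y b y).
Proof. by apply/mpiP/mcong_rel; exact: tensor_bal. Qed.

Definition tensor_lact (a : A) : tensor_space -> tensor_space :=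
  mlift (fun g => tensor_pure (lact X a g.1) g.2).
Definition tensor_ract (z : tensor_space) (c : C) : tensor_space :=
  mlift (fun g => tensor_pure g.1 (ract Y g.2 c)) z.

Lemma tensor_lact_rel a t u : tensor_rel t u ->
  mtermE (fun g => tensor_pure (lact X a g.1) g.2) t =
  mtermE (fun g => tensor_pure (lact X a g.1) g.2) u.
Proof.
have [[_ _ _ linX _] _ LR] := bimodP X.
case=> [c x x' y|c x y y'|x b y] /=.
- by rewrite linX tensor_pure_linl.
- by rewrite tensor_pure_linr.
- by rewrite LR tensor_pure_bal.
Qed.

Lemma tensor_ract_rel c t u : tensor_rel t u ->
  mtermE (fun g => tensor_pure g.1 (ract Y g.2 c)) t =
  mtermE (fun g => tensor_pure g.1 (ract Y g.2 c)) u.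
Proof.
have [_ [_ _ _ linY _] LR] := bimodP Y.
case=> [d x x' y|d x y y'|x b y] /=.
- by rewrite tensor_pure_linl.
- by rewrite linY tensor_pure_linr.
- by rewrite -LR tensor_pure_bal.
Qed.

Lemma tensor_lact_lin a : linear (tensor_lact a).
Proof. exact: (mliftP (tensor_lact_rel a)).1. Qed.
Lemma tensor_ract_lin c : linear (tensor_ract^~ c).
Proof. exact: (mliftP (tensor_ract_rel c)).1. Qed.
Lemma tensor_lactE a x y :
  tensor_lact a (tensor_pure x y) = tensor_pure (lact X a x) y.
Proof. exact: (mliftP (tensor_lact_rel a)).2. Qed.
Lemma tensor_ractE x y c :
  tensor_ract (tensor_pure x y) c = tensor_pure x (ract Y y c).
Proof. exact: (mliftP (tensor_ract_rel c)).2. Qed.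

Lemma tensor_ind (P : tensor_space -> Prop) :
  P 0 -> (forall c z w, P z -> P w -> P (c *: z + w)) ->
  (forall x y, P (tensor_pure x y)) -> forall z, P z.
Proof.
move=> P0 PL Pt; apply: mpres_ind => // [z w Pz Pw|c z Pz|[x y]]; last exact: Pt.
  by rewrite -[z]scale1r; exact: PL.
by rewrite -[_ *: _]addr0; exact: PL.
Qed.

Lemma linear_0 (V W : lmodType k) (f : V -> W) : linear f -> f 0 = 0.
Proof. by move=> lf; have := lf (-1) 0 0; rewrite !scaleN1r !addNr. Qed.

Lemma tensor_bimodP : is_bimod tensor_lact tensor_ract.
Proof.
have [[X1 XM XD XL XK] _ XLR] := bimodP X.
have [_ [Y1 YM YD YL YK] YLR] := bimodP Y.
have l0 a := linear_0 (tensor_lact_lin a).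
have r0 c := linear_0 (tensor_ract_lin c).
have ll a := tensor_lact_lin a; have rl c := tensor_ract_lin c.
have tDl x x' y : tensor_pure (x + x') y = tensor_pure x y + tensor_pure x' y.
  by rewrite -[x]scale1r tensor_pure_linl !scale1r.
have tDr x y y' : tensor_pure x (y + y') = tensor_pure x y + tensor_pure x y'.
  by rewrite -[y]scale1r tensor_pure_linr !scale1r.
have tZl c x y : tensor_pure (c *: x) y = c *: tensor_pure x y.
  by have := tensor_pure_linl y c x 0;
    rewrite (linear_0 (tensor_pure_linl y)) !addr0.
have tZr c x y : tensor_pure x (c *: y) = c *: tensor_pure x y.
  by have := tensor_pure_linr x c y 0;
    rewrite (linear_0 (tensor_pure_linr x)) !addr0.
split; [split=> // |split=> // |].
- by elim/tensor_ind=> [|c z w IHz IHw|x y];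
    rewrite ?l0 // ?ll ?IHz ?IHw // tensor_lactE X1.
- move=> a b; elim/tensor_ind=> [|c z w IHz IHw|x y]; first by rewrite !l0.
    by rewrite !ll IHz IHw.
  by rewrite !tensor_lactE XM.
- move=> a b; elim/tensor_ind=> [|c z w IHz IHw|x y].
  + by rewrite !l0 addr0.
  + by rewrite !ll IHz IHw scalerDr addrACA.
  + by rewrite !tensor_lactE XD tDl.
- move=> c; elim/tensor_ind=> [|d z w IHz IHw|x y].
  + by rewrite l0 scaler0.
  + by rewrite ll IHz IHw scalerDr !scalerA mulrC.
  + by rewrite tensor_lactE XK tZl.
- by elim/tensor_ind=> [|c z w IHz IHw|x y];
    rewrite ?r0 // ?rl ?IHz ?IHw // tensor_ractE Y1.
- move=> z a b; elim/tensor_ind: z => [|c z w IHz IHw|x y]; first by rewrite !r0.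
    by rewrite !rl IHz IHw.
  by rewrite !tensor_ractE YM.
- move=> z a b; elim/tensor_ind: z => [|c z w IHz IHw|x y].
  + by rewrite !r0 addr0.
  + by rewrite !rl IHz IHw scalerDr addrACA.
  + by rewrite !tensor_ractE YD tDr.
- move=> c; elim/tensor_ind=> [|d z w IHz IHw|x y].
  + by rewrite r0 scaler0.
  + by rewrite rl IHz IHw scalerDr !scalerA mulrC.
  + by rewrite tensor_ractE YK tZr.
- move=> a z c; elim/tensor_ind: z => [|d z w IHz IHw|x y].
  + by rewrite !(l0, r0).
  + by rewrite !(ll, rl) IHz IHw.
  + by rewrite !(tensor_lactE, tensor_ractE).
Qed.

Definition tensor : bimod A C := Bimod tensor_bimodP.

Definition tpure (x : X) (y : Y) : tensor := tensor_pure x y.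

End Tensor.

Record graph := Graph {
  vert : finType;
  edge : finType;
  src : edge -> vert;
  rng : edge -> vert
}.
Arguments src {g}.
Arguments rng {g}.

Definition no_sinks (E : graph) : Prop := forall v : vert E, exists e, src e = v.

(* kE^0 = functions E^0 -> k with the pointwise operations; the vertex v      *)
(* corresponds to its indicator function vtx k v. The type k^o is k seen as   *)
(* a k-module.                                                                *)
Definition kE0 (k : fieldType) (E : graph) : Type := {ffun vert E -> k^o}.
HB.instance Definition _ k E :=
  GRing.PzRing.copy (kE0 k E) {ffun vert E -> k^o}.
HB.instance Definition _ k E :=
  GRing.Lmodule.copy (kE0 k E) {ffun vert E -> k^o}.

Section VertexAlgebra.
Variables (k : fieldType) (E : graph).

Definition kE0_kmap (c : k) : kE0 k E := c *: (1 : kE0 k E).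

Fact kE0_kmap_zmod : zmod_morphism kE0_kmap.
Proof. by move=> c d; rewrite /kE0_kmap scalerBl. Qed.
Fact kE0_kmap_monoid : monoid_morphism kE0_kmap.
Proof.
split=> [|c d]; first exact: scale1r.
by apply/ffunP=> v; rewrite !ffunE -scalerAl mul1r scalerA.
Qed.
HB.instance Definition _ :=
  GRing.isZmodMorphism.Build k (kE0 k E) kE0_kmap kE0_kmap_zmod.
HB.instance Definition _ :=
  GRing.isMonoidMorphism.Build k (kE0 k E) kE0_kmap kE0_kmap_monoid.

Fact kE0_kmap_central (c : k) (x : kE0 k E) : kE0_kmap c * x = x * kE0_kmap c.
Proof. by apply/ffunP=> v; rewrite !ffunE mulrC. Qed.
HB.instance Definition _ := isKAlgebra.Build k (kE0 k E) kE0_kmap_central.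

Definition vtx (v : vert E) : kE0 k E := [ffun w => (w == v)%:R].

Definition kE1_space : lmodType k := {ffun edge E -> k^o}.

Definition kE1_lact (a : kE0 k E) (y : kE1_space) : kE1_space :=
  [ffun e => a (src e) * y e].
Definition kE1_ract (y : kE1_space) (b : kE0 k E) : kE1_space :=
  [ffun e => y e * b (rng e)].

Lemma kE1_bimodP : is_bimod kE1_lact kE1_ract.
Proof.
split; [split|split|].
- by move=> x; apply/ffunP=> e; rewrite !ffunE mul1r.
- by move=> a b x; apply/ffunP=> e; rewrite !ffunE mulrA.
- by move=> a b x; apply/ffunP=> e; rewrite !ffunE mulrDl.
- by move=> a c x y; apply/ffunP=> e; rewrite !ffunE mulrDr scalerAr.
- by move=> c x; apply/ffunP=> e; rewrite !ffunE -scalerAl mul1r.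
- by move=> x; apply/ffunP=> e; rewrite !ffunE mulr1.
- by move=> x a b; apply/ffunP=> e; rewrite !ffunE mulrA.
- by move=> x a b; apply/ffunP=> e; rewrite !ffunE mulrDr.
- by move=> b c x y; apply/ffunP=> e; rewrite !ffunE mulrDl scalerAl.
- by move=> c x; apply/ffunP=> e; rewrite !ffunE -scalerAr mulr1.
- by move=> a x b; apply/ffunP=> e; rewrite !ffunE mulrA.
Qed.

Definition kE1 : bimod (kE0 k E) (kE0 k E) := Bimod kE1_bimodP.

Definition edg (e : edge E) : kE1 := [ffun e' => (e' == e)%:R] : kE1_space.

End VertexAlgebra.

Inductive lterm (k : pzRingType) (E : graph) : Type :=
| LVert of vert E
| LEdge of edge E
| LGhost of edge E
| LZero
| LAdd of lterm k E & lterm k E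
| LScale of k & lterm k E
| LMul of lterm k E & lterm k E.
Arguments LVert {k E}.
Arguments LEdge {k E}.
Arguments LGhost {k E}.
Arguments LZero {k E}.

HB.instance Definition _ (k : pzRingType) (E : graph) :=
  gen_eqMixin (lterm k E).
HB.instance Definition _ (k : pzRingType) (E : graph) :=
  gen_choiceMixin (lterm k E).

Inductive lrel (k : pzRingType) (E : graph) : lterm k E -> lterm k E -> Prop :=
| lrel_vv v u : lrel (LMul (LVert v) (LVert u)) (if v == u then LVert v else LZero)
| lrel_se e : lrel (LMul (LVert (src e)) (LEdge e)) (LEdge e)
| lrel_er e : lrel (LMul (LEdge e) (LVert (rng e))) (LEdge e)
| lrel_re e : lrel (LMul (LVert (rng e)) (LGhost e)) (LGhost e)
| lrel_es e : lrel (LMul (LGhost e) (LVert (src e))) (LGhost e)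
| lrel_ee e e' :
    lrel (LMul (LGhost e) (LEdge e')) (if e == e' then LVert (rng e) else LZero)
(* This relation is meant for graphs without sinks: it kills a sink. *)
| lrel_sum v : lrel (LVert v)
    (\big[@LAdd k E/LZero]_(e | src e == v) LMul (LEdge e) (LGhost e)).

(* The least congruence containing lrel and making the quotient an            *)
(* associative, not necessarily unital, k-algebra.                            *)
Inductive lcong (k : pzRingType) (E : graph) : lterm k E -> lterm k E -> Prop :=
| lcong_rel t u : lrel t u -> lcong t u
| lcong_refl t : lcong t t
| lcong_sym t u : lcong t u -> lcong u t
| lcong_trans u t w : lcong t u -> lcong u w -> lcong t w
| lcong_add t t' u u' : lcong t t' -> lcong u u' -> lcong (LAdd t u) (LAdd t' u')
| lcong_scale c t t' : lcong t t' -> lcong (LScale c t) (LScale c t')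
| lcong_mul t t' u u' : lcong t t' -> lcong u u' -> lcong (LMul t u) (LMul t' u')
| lcong_addA t u w : lcong (LAdd t (LAdd u w)) (LAdd (LAdd t u) w)
| lcong_addC t u : lcong (LAdd t u) (LAdd u t)
| lcong_add0 t : lcong (LAdd LZero t) t
| lcong_scaleA c d t : lcong (LScale c (LScale d t)) (LScale (c * d) t)
| lcong_scale0 t : lcong (LScale 0 t) LZero
| lcong_scale1 t : lcong (LScale 1 t) t
| lcong_scaleDr c t u :
    lcong (LScale c (LAdd t u)) (LAdd (LScale c t) (LScale c u))
| lcong_scaleDl c d t : lcong (LScale (c + d) t) (LAdd (LScale c t) (LScale d t))
| lcong_mulA t u w : lcong (LMul t (LMul u w)) (LMul (LMul t u) w)
| lcong_mulDl t u w : lcong (LMul (LAdd t u) w) (LAdd (LMul t w) (LMul u w))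
| lcong_mulDr t u w : lcong (LMul t (LAdd u w)) (LAdd (LMul t u) (LMul t w))
| lcong_scaleAl c t u : lcong (LScale c (LMul t u)) (LMul (LScale c t) u)
| lcong_scaleAr c t u : lcong (LScale c (LMul t u)) (LMul t (LScale c u)).

Section Leavitt.
Variables (k : fieldType) (E : graph).

Definition lcongb (t u : lterm k E) : bool := `[< lcong t u >].

Lemma lcongb_refl : reflexive lcongb.
Proof. by move=> t; apply/asboolP; exact: lcong_refl. Qed.
Lemma lcongb_sym : symmetric lcongb.
Proof. by move=> t u; apply/asboolP/asboolP; exact: lcong_sym. Qed.
Lemma lcongb_trans : transitive lcongb.
Proof.
by move=> u t w /asboolP tu /asboolP uw; apply/asboolP; exact: lcong_trans tu uw.
Qed.
Canonical lcong_equiv := EquivRel lcongb lcongb_refl lcongb_sym lcongb_trans.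

Definition leavitt := {eq_quot lcong_equiv}.
HB.instance Definition _ := Choice.on leavitt.

Definition lpi (t : lterm k E) : leavitt := \pi_{eq_quot lcong_equiv} t.

Lemma lpiP t u : lpi t = lpi u <-> lcong t u.
Proof.
split=> [/eqmodP/asboolP //|tu]; apply/eqmodP; exact/asboolP.
Qed.

Lemma lpi_surj (x : leavitt) : exists t, x = lpi t.
Proof. by exists (repr x); rewrite /lpi reprK. Qed.

Lemma lrepr t : lcong (repr (lpi t)) t.
Proof. by apply/lpiP; rewrite /lpi reprK. Qed.

Definition leavitt_add (x y : leavitt) : leavitt := lpi (LAdd (repr x) (repr y)).
Definition leavitt_scale (c : k) (x : leavitt) : leavitt :=
  lpi (LScale c (repr x)).
Definition leavitt_mul (x y : leavitt) : leavitt := lpi (LMul (repr x) (repr y)).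
Definition leavitt_zero : leavitt := lpi LZero.
Definition leavitt_opp (x : leavitt) : leavitt := leavitt_scale (-1) x.

Lemma lpiD t u : leavitt_add (lpi t) (lpi u) = lpi (LAdd t u).
Proof. by apply/lpiP; apply: lcong_add; exact: lrepr. Qed.
Lemma lpiZ c t : leavitt_scale c (lpi t) = lpi (LScale c t).
Proof. by apply/lpiP; apply: lcong_scale; exact: lrepr. Qed.
Lemma lpiM t u : leavitt_mul (lpi t) (lpi u) = lpi (LMul t u).
Proof. by apply/lpiP; apply: lcong_mul; exact: lrepr. Qed.

Fact leavitt_addA : associative leavitt_add.
Proof.
move=> x y z; have [t ->] := lpi_surj x; have [u ->] := lpi_surj y.
by have [w ->] := lpi_surj z; rewrite !lpiD; apply/lpiP; exact: lcong_addA.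
Qed.
Fact leavitt_addC : commutative leavitt_add.
Proof.
move=> x y; have [t ->] := lpi_surj x; have [u ->] := lpi_surj y.
by rewrite !lpiD; apply/lpiP; exact: lcong_addC.
Qed.
Fact leavitt_add0 : left_id leavitt_zero leavitt_add.
Proof.
by move=> x; have [t ->] := lpi_surj x; rewrite lpiD; apply/lpiP/lcong_add0.
Qed.
Fact leavitt_addN : left_inverse leavitt_zero leavitt_opp leavitt_add.
Proof.
move=> x; have [t ->] := lpi_surj x.
rewrite /leavitt_opp lpiZ lpiD; apply/lpiP.
apply: (lcong_trans (u := LAdd (LScale (-1) t) (LScale 1 t))).
  by apply: lcong_add; [exact: lcong_refl|apply/lcong_sym/lcong_scale1].
apply: (lcong_trans (u := LScale (-1 + 1) t)).
  exact/lcong_sym/lcong_scaleDl.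
by rewrite addNr; exact: lcong_scale0.
Qed.
HB.instance Definition _ := GRing.isZmodule.Build leavitt
  leavitt_addA leavitt_addC leavitt_add0 leavitt_addN.

Fact leavitt_scaleA a b (x : leavitt) :
  leavitt_scale a (leavitt_scale b x) = leavitt_scale (a * b) x.
Proof.
by have [t ->] := lpi_surj x; rewrite !lpiZ; apply/lpiP/lcong_scaleA.
Qed.
Fact leavitt_scale1 : left_id 1 leavitt_scale.
Proof.
by move=> x; have [t ->] := lpi_surj x; rewrite lpiZ; apply/lpiP/lcong_scale1.
Qed.
Fact leavitt_scaleDr : right_distributive leavitt_scale +%R.
Proof.
move=> c x y; have [t ->] := lpi_surj x; have [u ->] := lpi_surj y.
rewrite /GRing.add /= lpiD !lpiZ lpiD; exact/lpiP/lcong_scaleDr.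
Qed.
Fact leavitt_scaleDl (x : leavitt) : {morph leavitt_scale^~ x : a b / a + b}.
Proof.
move=> c d; have [t ->] := lpi_surj x.
rewrite [RHS]/GRing.add /= !lpiZ lpiD; exact/lpiP/lcong_scaleDl.
Qed.
HB.instance Definition _ := GRing.Zmodule_isLmodule.Build k leavitt
  leavitt_scaleA leavitt_scale1 leavitt_scaleDr leavitt_scaleDl.

Definition lvert (v : vert E) : leavitt := lpi (LVert v).
Definition ledge (e : edge E) : leavitt := lpi (LEdge e).
Definition lghost (e : edge E) : leavitt := lpi (LGhost e).

Fact leavitt_mulA : associative leavitt_mul.
Proof.
move=> x y z; have [t ->] := lpi_surj x; have [u ->] := lpi_surj y.
by have [w ->] := lpi_surj z; rewrite !lpiM; apply/lpiP; exact: lcong_mulA.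
Qed.
Fact leavitt_mulDl : left_distributive leavitt_mul +%R.
Proof.
move=> x y z; have [t ->] := lpi_surj x; have [u ->] := lpi_surj y.
have [w ->] := lpi_surj z; rewrite /GRing.add /= !(lpiM, lpiD).
exact/lpiP/lcong_mulDl.
Qed.
Fact leavitt_mulDr : right_distributive leavitt_mul +%R.
Proof.
move=> x y z; have [t ->] := lpi_surj x; have [u ->] := lpi_surj y.
have [w ->] := lpi_surj z; rewrite /GRing.add /= !(lpiM, lpiD).
exact/lpiP/lcong_mulDr.
Qed.
Fact leavitt_mulZl c (x y : leavitt) :
  c *: leavitt_mul x y = leavitt_mul (c *: x) y.
Proof.
have [t ->] := lpi_surj x; have [u ->] := lpi_surj y.
rewrite /GRing.scale /= !(lpiM, lpiZ); exact/lpiP/lcong_scaleAl.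
Qed.
Fact leavitt_mulZr c (x y : leavitt) :
  c *: leavitt_mul x y = leavitt_mul x (c *: y).
Proof.
have [t ->] := lpi_surj x; have [u ->] := lpi_surj y.
rewrite /GRing.scale /= !(lpiM, lpiZ); exact/lpiP/lcong_scaleAr.
Qed.
Fact leavitt_mul0l x : leavitt_mul 0 x = 0.
Proof. by have := leavitt_mulZl 0 0 x; rewrite !scale0r => <-. Qed.
Fact leavitt_mul0r x : leavitt_mul x 0 = 0.
Proof. by have := leavitt_mulZr 0 x 0; rewrite !scale0r => <-. Qed.

Definition leavitt_one : leavitt := \sum_v lvert v.

Lemma leavitt_vv v u : leavitt_mul (lvert v) (lvert u) = if v == u then lvert v else 0.
Proof.
rewrite /lvert lpiM; case: ifP (lrel_vv k v u) => _ rel; exact/lpiP/lcong_rel.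
Qed.

Lemma leavitt_suml (f : vert E -> leavitt) y :
  leavitt_mul (\sum_v f v) y = \sum_v leavitt_mul (f v) y.
Proof.
apply: (big_morph (leavitt_mul^~ y)); last exact: leavitt_mul0l.
by move=> a b; exact: leavitt_mulDl.
Qed.
Lemma leavitt_sumr (f : vert E -> leavitt) y :
  leavitt_mul y (\sum_v f v) = \sum_v leavitt_mul y (f v).
Proof.
apply: (big_morph (leavitt_mul y)); last exact: leavitt_mul0r.
by move=> a b; exact: leavitt_mulDr.
Qed.

Lemma leavitt_one_l v x : leavitt_mul (lvert v) x = x -> leavitt_mul leavitt_one x = x.
Proof.
move=> vx; rewrite leavitt_suml (bigD1 v) //= vx big1 ?addr0 // => u uv.
by rewrite -vx leavitt_mulA leavitt_vv (negbTE uv) leavitt_mul0l.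
Qed.
Lemma leavitt_one_r v x : leavitt_mul x (lvert v) = x -> leavitt_mul x leavitt_one = x.
Proof.
move=> xv; rewrite leavitt_sumr (bigD1 v) //= xv big1 ?addr0 // => u uv.
by rewrite -xv -leavitt_mulA leavitt_vv eq_sym (negbTE uv) leavitt_mul0r.
Qed.

Fact leavitt_mul1l : left_id leavitt_one leavitt_mul.
Proof.
move=> x; have [t ->] := lpi_surj x.
elim: t => [v|e|e||t IHt u IHu|c t IHt|t IHt u _].
- by apply: (@leavitt_one_l v); rewrite leavitt_vv eqxx.
- by apply: (@leavitt_one_l (src e)); rewrite lpiM; apply/lpiP/lcong_rel/lrel_se.
- by apply: (@leavitt_one_l (rng e)); rewrite lpiM; apply/lpiP/lcong_rel/lrel_re.
- exact: leavitt_mul0r.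
- by have := leavitt_mulDr leavitt_one (lpi t) (lpi u);
    rewrite /GRing.add /= IHt IHu lpiD.
- by have := leavitt_mulZr c leavitt_one (lpi t);
    rewrite /GRing.scale /= IHt lpiZ.
- by rewrite -lpiM leavitt_mulA IHt.
Qed.
Fact leavitt_mul1r : right_id leavitt_one leavitt_mul.
Proof.
move=> x; have [t ->] := lpi_surj x.
elim: t => [v|e|e||t IHt u IHu|c t IHt|t _ u IHu].
- by apply: (@leavitt_one_r v); rewrite leavitt_vv eqxx.
- by apply: (@leavitt_one_r (rng e)); rewrite lpiM; apply/lpiP/lcong_rel/lrel_er.
- by apply: (@leavitt_one_r (src e)); rewrite lpiM; apply/lpiP/lcong_rel/lrel_es.
- exact: leavitt_mul0l.
- by have := leavitt_mulDl (lpi t) (lpi u) leavitt_one;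
    rewrite /GRing.add /= IHt IHu lpiD.
- by have := leavitt_mulZl c (lpi t) leavitt_one;
    rewrite /GRing.scale /= IHt lpiZ.
- by rewrite -lpiM -leavitt_mulA IHu.
Qed.

HB.instance Definition _ := GRing.Zmodule_isPzRing.Build leavitt
  leavitt_mulA leavitt_mul1l leavitt_mul1r leavitt_mulDl leavitt_mulDr.

Lemma leavitt_scaleAl c (x y : leavitt) : c *: (x * y) = (c *: x) * y.
Proof. exact: leavitt_mulZl. Qed.
Lemma leavitt_scaleAr c (x y : leavitt) : c *: (x * y) = x * (c *: y).
Proof. exact: leavitt_mulZr. Qed.

Definition leavitt_kmap (c : k) : leavitt := c *: (1 : leavitt).

Fact leavitt_kmap_zmod : zmod_morphism leavitt_kmap.
Proof. by move=> c d; rewrite /leavitt_kmap scalerBl. Qed.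
Fact leavitt_kmap_monoid : monoid_morphism leavitt_kmap.
Proof.
split=> [|c d]; first exact: scale1r.
by rewrite /leavitt_kmap -leavitt_scaleAl mul1r scalerA.
Qed.
HB.instance Definition _ :=
  GRing.isZmodMorphism.Build k leavitt leavitt_kmap leavitt_kmap_zmod.
HB.instance Definition _ :=
  GRing.isMonoidMorphism.Build k leavitt leavitt_kmap leavitt_kmap_monoid.

Fact leavitt_kmap_central (c : k) (x : leavitt) :
  leavitt_kmap c * x = x * leavitt_kmap c.
Proof.
by rewrite /leavitt_kmap -leavitt_scaleAl -leavitt_scaleAr mul1r mulr1.
Qed.
HB.instance Definition _ := isKAlgebra.Build k leavitt leavitt_kmap_central.

Lemma lpi_add t u : lpi (LAdd t u) = lpi t + lpi u.
Proof. by rewrite -lpiD. Qed.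
Lemma lpi_scale c t : lpi (LScale c t) = c *: lpi t.
Proof. by rewrite -lpiZ. Qed.
Lemma lpi_mul t u : lpi (LMul t u) = lpi t * lpi u.
Proof. by rewrite -lpiM. Qed.

Lemma leavitt_oneE : 1 = \sum_v lvert v.
Proof. by []. Qed.

Lemma lvM v u : lvert v * lvert u = if v == u then lvert v else 0.
Proof. exact: leavitt_vv. Qed.
Lemma src_le e : lvert (src e) * ledge e = ledge e.
Proof. by rewrite -lpi_mul; apply/lpiP/lcong_rel/lrel_se. Qed.
Lemma le_rng e : ledge e * lvert (rng e) = ledge e.
Proof. by rewrite -lpi_mul; apply/lpiP/lcong_rel/lrel_er. Qed.
Lemma rng_ls e : lvert (rng e) * lghost e = lghost e.
Proof. by rewrite -lpi_mul; apply/lpiP/lcong_rel/lrel_re. Qed.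
Lemma ls_src e : lghost e * lvert (src e) = lghost e.
Proof. by rewrite -lpi_mul; apply/lpiP/lcong_rel/lrel_es. Qed.
Lemma ls_le e e' : lghost e * ledge e' = if e == e' then lvert (rng e) else 0.
Proof.
rewrite -lpi_mul; case: ifP (lrel_ee k e e') => _ rel; exact/lpiP/lcong_rel.
Qed.
Lemma lv_sum v : lvert v = \sum_(e | src e == v) ledge e * lghost e.
Proof.
rewrite /lvert (proj2 (lpiP _ _) (lcong_rel (lrel_sum k v))).
rewrite (@big_morph _ _ lpi 0 +%R) //; last exact: lpi_add.
by apply: eq_bigr => e _; rewrite lpi_mul.
Qed.

Definition vemb (a : kE0 k E) : leavitt := \sum_v a v *: lvert v.
Definition eemb (y : kE1 k E) : leavitt := \sum_e (y : kE1_space k E) e *: ledge e.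

Lemma vemb_linear : linear vemb.
Proof.
move=> c a b; rewrite /vemb scaler_sumr -big_split; apply: eq_bigr => v _.
by rewrite !ffunE scalerDl scalerA.
Qed.
Lemma vemb1 : vemb 1 = 1.
Proof.
by rewrite /vemb leavitt_oneE; apply: eq_bigr => v _; rewrite ffunE scale1r.
Qed.
Lemma vembM a b : vemb (a * b) = vemb a * vemb b.
Proof.
rewrite /vemb mulr_suml; apply: eq_bigr => v _; rewrite mulr_sumr.
rewrite (bigD1 v) //= big1 => [|u uv].
  by rewrite -leavitt_scaleAl -leavitt_scaleAr lvM eqxx addr0 scalerA ffunE.
by rewrite -leavitt_scaleAl -leavitt_scaleAr lvM eq_sym (negbTE uv) !scaler0.
Qed.

Lemma leavitt_bimodP :
  is_bimod (fun (a : kE0 k E) (S : leavitt) => vemb a * S)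
           (fun S S' : leavitt => S * S').
Proof.
split; [split|split|].
- by move=> x; rewrite vemb1 mul1r.
- by move=> a b x; rewrite vembM mulrA.
- by move=> a b x; rewrite -[a]scale1r vemb_linear !scale1r mulrDl.
- by move=> a c x y; rewrite mulrDr leavitt_scaleAr.
- move=> c x; have := vemb_linear c 1 0.
  rewrite (linear_0 vemb_linear) !addr0 vemb1 => ->.
  by rewrite -leavitt_scaleAl mul1r.
- by move=> x; rewrite mulr1.
- by move=> x a b; rewrite mulrA.
- by move=> x a b; rewrite mulrDr.
- by move=> b c x y; rewrite mulrDl leavitt_scaleAl.
- by move=> c x; rewrite -leavitt_scaleAr mulr1.
- by move=> a x b; rewrite mulrA.
Qed.

Definition leavitt_bimod : bimod (kE0 k E) leavitt := Bimod leavitt_bimodP.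

(* The element e^* y of kE^0, for y in kE^1; it is characterized by ghost_mulE *)
(* and vemb_inj.                                                              *)
Definition ghost_mul (e : edge E) (y : kE1 k E) : kE0 k E :=
  (y : kE1_space k E) e *: vtx k (rng e).

Lemma vemb_vtx v : vemb (vtx k v) = lvert v.
Proof.
rewrite /vemb (bigD1 v) //= big1 => [|u uv]; rewrite ffunE.
  by rewrite eqxx scale1r addr0.
by rewrite (negbTE uv) scale0r.
Qed.

Lemma ghost_mulE e y : vemb (ghost_mul e y) = lghost e * eemb y.
Proof.
have := vemb_linear ((y : kE1_space k E) e) (vtx k (rng e)) 0.
rewrite (linear_0 vemb_linear) !addr0 vemb_vtx => ->.
rewrite /eemb mulr_sumr (bigD1 e) //= big1 => [|u ue].
  by rewrite -leavitt_scaleAr ls_le eqxx addr0.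
by rewrite -leavitt_scaleAr ls_le eq_sym (negbTE ue) scaler0.
Qed.

Fixpoint is_path (v : vert E) (p : seq (edge E)) : bool :=
  if p is e :: p' then (src e == v) && is_path (rng e) p' else true.

(* For p = e_1 ... e_n with is_path v p, the elements of L_k(E) given by the  *)
(* path p and by p^* = e_n^* ... e_1^*; the vertex v if n = 0.                *)
Definition path_elt (v : vert E) (p : seq (edge E)) : leavitt :=
  lvert v * \prod_(e <- p) ledge e.
Definition path_ghost (v : vert E) (p : seq (edge E)) : leavitt :=
  (\prod_(e <- rev p) lghost e) * lvert v.

End Leavitt.

Arguments lvert k {E}.
Arguments ledge k {E}.
Arguments lghost k {E}.

(* L_k(E) acts on the functions on infinite paths; hence kE^0 embeds in it.   *)
Section Embedding.
Variables (k : fieldType) (E : graph).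
Let X := nat -> edge E.
Let F := X -> k.

Let inf_path (x : X) : bool := `[< forall n, rng (x n) = src (x n.+1) >].
Let shift (x : X) : X := fun n => x n.+1.
Let cons (e : edge E) (x : X) : X := fun n => if n is n'.+1 then x n' else e.

Let rep := fix rep (t : lterm k E) (f : F) : F := match t with
  | LVert v => fun x => if inf_path x && (src (x 0%N) == v) then f x else 0
  | LEdge e => fun x => if inf_path x && (x 0%N == e) then f (shift x) else 0
  | LGhost e =>
      fun x => if inf_path x && (src (x 0%N) == rng e) then f (cons e x) else 0
  | LZero => fun=> 0
  | LAdd t u => fun x => rep t f x + rep u f x
  | LScale c t => fun x => c * rep t f x
  | LMul t u => rep t (rep u f)
  end.

Let rep_lin t c (f g : F) x :
  rep t (fun y => c * f y + g y) x = c * rep t f x + rep t g x.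
Proof.
elim: t f g x => [v|e|e||t IHt u IHu|d t IHt|t IHt u IHu] f g x /=.
- by case: ifP => // _; rewrite mulr0 addr0.
- by case: ifP => // _; rewrite mulr0 addr0.
- by case: ifP => // _; rewrite mulr0 addr0.
- by rewrite mulr0 addr0.
- by rewrite IHt IHu mulrDr addrACA.
- by rewrite IHt mulrDr !mulrA (mulrC d).
- by rewrite -IHt; congr (rep t _ x); apply/funext => y; rewrite IHu.
Qed.

Let rep0 t x : rep t (fun=> 0) x = 0.
Proof.
transitivity (rep t (fun y => -1 * (fun=> 0) y + (fun=> 0) y) x).
  by congr (rep t _ x); apply/funext => y; rewrite mulr0 addr0.
by rewrite rep_lin mulN1r addNr.
Qed.

Let inf_path_shift x : inf_path x ->
  inf_path (shift x) /\ src (x 1%N) = rng (x 0%N).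
Proof. by move=> /asboolP xP; split=> //; apply/asboolP=> n; exact: xP. Qed.

Let inf_path_cons e x : inf_path x ->
  src (x 0%N) = rng e -> inf_path (cons e x).
Proof. by move=> /asboolP xP x0; apply/asboolP => -[|n] /=. Qed.

Let rep_rel t u : lrel t u -> rep t = rep u.
Proof.
case=> [v w|e|e|e|e|e e'|v]; apply/funext=> f; apply/funext=> x /=.
- case: ifP => [/andP[xP /eqP sx]|nx].
    by rewrite xP sx /=; case: eqVneq => [_|_] /=; rewrite ?xP ?sx ?eqxx.
  by case: eqP => //= _; rewrite nx.
- case: (boolP (inf_path x)) => //= _.
  by case: (eqVneq (x 0%N) e) => [->|]; rewrite ?eqxx ?if_same.
- case: (boolP (inf_path x)) => //= /inf_path_shift[xP sx].
  by case: eqP => // <-; rewrite xP /shift sx eqxx.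
- by case: (boolP (inf_path x)) => //= _; case: (src _ == _).
- case: (boolP (inf_path x)) => //= xP; case: eqP => // sx.
  by rewrite inf_path_cons //= eqxx.
- case: (boolP (inf_path x)) => /= xP; last first.
    by case: eqP => //= _; rewrite (negbTE xP).
  case: (eqVneq (src (x 0%N)) (rng e)) => sx; last first.
    by case: eqP => //= _; rewrite (negbTE sx) andbF.
  by rewrite inf_path_cons //=; case: eqP => //= _; rewrite xP sx eqxx.
- rewrite (@big_morph _ _ (fun t => rep t f x) 0 +%R) //=.
  case: (boolP (inf_path x)) => /= xP; last by rewrite big1.
  have [yP sx] := inf_path_shift xP.
  under eq_bigr do rewrite yP /shift sx /=.
  case: eqVneq => [sv|sv].
    rewrite (bigD1 (x 0%N)) /= ?sv // eqxx big1 ?addr0 => [|e /andP[_ ne]].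
      by rewrite eqxx; congr f; apply/funext => -[|n].
    by rewrite eq_sym (negbTE ne).
  by rewrite big1 // => e /eqP se; case: eqP => // xe; rewrite -se -xe eqxx in sv.
Qed.

Let rep_cong t u : lcong t u -> rep t = rep u.
Proof.
have ext (g h : F -> F) : (forall f x, g f x = h f x) -> g = h.
  by move=> gh; apply/funext => f; apply/funext => x.
elim=> {t u} //=.
- by move=> u t w _ -> _ ->.
- by move=> t t' u u' _ -> _ ->.
- by move=> c t t' _ ->.
- by move=> t t' u u' _ -> _ ->.
- by move=> t u w; apply: ext => f x; rewrite addrA.
- by move=> t u; apply: ext => f x; rewrite addrC.
- by move=> t; apply: ext => f x; rewrite add0r.
- by move=> c d t; apply: ext => f x; rewrite mulrA.
- by move=> t; apply: ext => f x; rewrite mul0r.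
- by move=> t; apply: ext => f x; rewrite mul1r.
- by move=> c t u; apply: ext => f x; rewrite mulrDr.
- by move=> c d t; apply: ext => f x; rewrite mulrDl.
- move=> t u w; apply: ext => f x.
  rewrite -[X in _ = X + _]mul1r -rep_lin; congr (rep t _ x).
  by apply/funext => y; rewrite mul1r.
- move=> c t u; apply: ext => f x.
  rewrite -[LHS]addr0 -(rep0 t x) -rep_lin; congr (rep t _ x).
  by apply/funext => y; rewrite addr0.
Qed.

Let repl (S : leavitt k E) (x : X) : k := rep (repr S) (fun=> 1) x.

Let repl_pi t x : repl (lpi t) x = rep t (fun=> 1) x.
Proof. by rewrite /repl (rep_cong (lrepr t)). Qed.

Let repl_lin c (S T : leavitt k E) x :
  repl (c *: S + T) x = c * repl S x + repl T x.
Proof.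
have [s ->] := lpi_surj S; have [t ->] := lpi_surj T.
by rewrite -lpi_scale -lpi_add !repl_pi.
Qed.

Lemma vemb_inj : no_sinks E -> injective (@vemb k E).
Proof.
move=> ns a b eab; apply/ffunP => v.
have exS w : exists e : edge E, src e == w by have [e <-] := ns w; exists e.
pose x := fix x n :=
  if n is n'.+1 then xchoose (exS (rng (x n'))) else xchoose (exS v).
have xP : inf_path x.
  by apply/asboolP => n; rewrite -(eqP (xchooseP (exS (rng (x n))))).
have x0 : src (x 0%N) = v by exact: (eqP (xchooseP (exS v))).
suff Ev (c : kE0 k E) : repl (vemb c) x = c v by rewrite -!Ev eab.
have r0 : repl 0 x = 0 by rewrite repl_pi.
have rD S T : repl (S + T) x = repl S x + repl T x.
  by rewrite -[S]scale1r repl_lin mul1r scale1r.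
rewrite /vemb (@big_morph _ _ (fun S => repl S x) 0 +%R) // (bigD1 v) //=.
rewrite big1 => [|w wv]; rewrite -[_ *: _]addr0 repl_lin r0 repl_pi /= xP x0.
  by rewrite eqxx mulr1 !addr0.
by rewrite eq_sym (negbTE wv) mulr0 addr0.
Qed.
End Embedding.

Definition kspan (k : fieldType) (V : lmodType k) (P : V -> Prop) (x : V) : Prop :=
  exists (n : nat) (c : 'I_n -> k) (w : 'I_n -> V),
    (forall i, P (w i)) /\ x = \sum_(i < n) c i *: w i.

Definition leavitt_deg (k : fieldType) (E : graph) (n : int) : leavitt k E -> Prop :=
  kspan (fun x => exists (v w : vert E) (p q : seq (edge E)),
    [/\ is_path v p, is_path w q, (size p)%:Z - (size q)%:Z = n &
        x = path_elt k v p * path_ghost k w q]).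

Definition is_subspace (k : fieldType) (V : lmodType k) (P : V -> Prop) : Prop :=
  P 0 /\ forall (c : k) x y, P x -> P y -> P (c *: x + y).

Definition is_direct_sum (V : zmodType) (Y : int -> V -> Prop) : Prop :=
  (forall x : V, exists (s : seq int) (y : int -> V),
     (forall n, Y n (y n)) /\ x = \sum_(n <- s) y n) /\
  (forall (s : seq int) (y : int -> V), uniq s -> (forall n, Y n (y n)) ->
     \sum_(n <- s) y n = 0 -> forall n, n \in s -> y n = 0).

Definition is_graded_bimod (k : fieldType) (A B : kAlgType k) (V : lmodType k)
    (gA : int -> A -> Prop) (gB : int -> B -> Prop)
    (la : A -> V -> V) (ra : V -> B -> V) (Y : int -> V -> Prop) : Prop :=
  [/\ forall n, is_subspace (Y n),
      is_direct_sum Y,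
      forall a n x y, gA a x -> Y n y -> Y (n + a) (la x y) &
      forall b n x y, gB b x -> Y n y -> Y (n + b) (ra y x)].

Section MLF.
Variables (k : fieldType) (E F : graph) (M : bimod (kE0 k E) (kE0 k F)).

Definition MLF : bimod (kE0 k E) (leavitt k F) := tensor M (leavitt_bimod k F).

Definition mlf (m : M) (S : leavitt k F) : MLF :=
  @tpure k _ _ _ M (leavitt_bimod k F) m S.

Definition MLF_deg (n : int) : MLF -> Prop :=
  kspan (fun z => exists (x : M) (S : leavitt k F),
    leavitt_deg n S /\ z = mlf x S).

Variable sigma : bimod_iso (tensor (kE1 k E) M) (tensor M (kE1 k F)).
Variable act : leavitt k E -> MLF -> MLF.

Definition vertex_relation : Prop :=
  forall (v : vert E) (m : M) (S : leavitt k F),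
    act (lvert k v) (mlf m S) = mlf (lact M (vtx k v) m) S.

Definition edge_relation : Prop :=
  forall (e : edge E) (m : M) (S : leavitt k F)
         (n : nat) (m_ : 'I_n -> M) (y_ : 'I_n -> kE1 k F),
    sigma (tpure (edg k e) m) = \sum_(i < n) tpure (m_ i) (y_ i) ->
    act (ledge k e) (mlf m S) = \sum_(i < n) mlf (m_ i) (eemb (y_ i) * S).

Definition ghost_relation : Prop :=
  forall (e : edge E) (m : M) (S : leavitt k F) (n : edge F -> nat)
         (y_ : forall f, 'I_(n f) -> kE1 k E) (m_ : forall f, 'I_(n f) -> M),
    (forall f, iso_inv sigma (tpure m (edg k f)) =
               \sum_(i < n f) tpure (y_ f i) (m_ f i)) ->
    act (lghost k e) (mlf m S) =
    \sum_f \sum_(i < n f)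
       mlf (lact M (ghost_mul e (y_ f i)) (m_ f i)) (lghost k f * S).

Definition ghost_relation_edge : Prop :=
  forall (e : edge E) (m : M) (g : edge F)
         (n : nat) (y_ : 'I_n -> kE1 k E) (m_ : 'I_n -> M),
    iso_inv sigma (tpure m (edg k g)) = \sum_(i < n) tpure (y_ i) (m_ i) ->
    act (lghost k e) (mlf m (ledge k g)) =
    \sum_(i < n) mlf (lact M (ghost_mul e (y_ i)) (m_ i)) (lvert k (rng g)).

End MLF.

(* Main.v *)
Require Import Defs.
From HB Require Import structures.
From mathcomp Require Import all_boot all_order all_algebra.
From mathcomp Require Import boolp functions.

Set Implicit Arguments.
Unset Strict Implicit.
Unset Printing Implicit Defensive.

Import GRing.Theory.
Local Open Scope ring_scope.

(** By the universal property of L_k(E), a left L_k(E)-module is a vector space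
    with one operator for each vertex v, edge e and ghost edge e^*, subject to
    the defining relations ([leavitt_act_lmod]). On M (x) L_k(F) the operators
    are dictated by the formulas of the theorem. The operator of e sends
    m (x) S to sigma(e (x) m), whose factor in kF^1 is then multiplied into S
    ([absorb]). The operator of e^* inserts 1 = sum over f of f f^*, turns each
    m (x) f into an element of kE^1 (x) M by sigma^-1, and contracts its factor
    in kE^1 with e^* ([strip]).

    Two of the relations have content ([mlf_family]). In e^* e' the sum over f
    collapses, because f^* y is the f-coordinate of y times r(f): it cancels
    the multiplication into S ([ghost_op_absorb]), so sigma^-1 meets sigma and
    what remains is the pairing of e^* with e'. In the sum of the e e^* over
    the edges e leaving v, the sum over e collapses because the e^* form the
    basis dual to E^1 ([sum_edg_strip]); then sigma meets sigma^-1 and the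
    sum of the f f^* is 1. Compatibility with the right action and uniqueness
    need to be verified only on the generators ([leavitt_intertwine]).

    For the grading, L_k(F) acts on sequences of its own elements indexed by
    the integers, each edge shifting the index by 1 and each ghost edge by -1.
    Applied to the sequence 1 placed at 0, this yields linear projections of
    L_k(F) onto its homogeneous components, linear over kF^0 on the left
    ([leavitt_proj_vemb]). Tensored with M they become projections of
    M (x) L_k(F) onto the Y_n, which makes the sum of the Y_n direct. That the
    left action respects degrees again needs to be seen only on generators
    ([leavitt_graded_action]). *)

(** * Linear maps and spans *)

Section LinearMaps.
Variables (k : fieldType) (U V : lmodType k) (f : U -> V).
Hypothesis lin_f : linear f.

Lemma linear_add x y : f (x + y) = f x + f y.
Proof. by rewrite -[x]scale1r lin_f !scale1r. Qed.

Lemma linear_scale c x : f (c *: x) = c *: f x.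
Proof. by have := lin_f c x 0; rewrite (linear_0 lin_f) !addr0. Qed.

Lemma linear_big I (r : seq I) (P : pred I) (F : I -> U) :
  f (\sum_(i <- r | P i) F i) = \sum_(i <- r | P i) f (F i).
Proof. exact: (big_morph f linear_add (linear_0 lin_f)). Qed.

Lemma preim_subspace (P : V -> Prop) :
  is_subspace P -> is_subspace (fun x => P (f x)).
Proof.
move=> [P0 PL]; split=> [|c x y Px Py]; first by rewrite (linear_0 lin_f).
by rewrite lin_f; exact: PL.
Qed.
End LinearMaps.

Lemma linear_comp (k : fieldType) (U V W : lmodType k) (f : V -> W)
    (g : U -> V) :
  linear f -> linear g -> linear (fun x => f (g x)).
Proof. by move=> lf lg c x y; rewrite lg lf. Qed.

Lemma linear_pointwise_sum (k : fieldType) (U V : lmodType k) (I : Type) (r : seq I)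
    (P : pred I) (f : I -> U -> V) :
  (forall i, linear (f i)) -> linear (fun x => \sum_(i <- r | P i) f i x).
Proof.
move=> lf c x y; rewrite scaler_sumr -big_split.
by apply: eq_bigr => i _; exact: lf.
Qed.

Section Subspaces.
Variables (k : fieldType) (V : lmodType k).
Implicit Types P Q : V -> Prop.

Lemma subspace_add P x y : is_subspace P -> P x -> P y -> P (x + y).
Proof. by move=> [_ PL] Px Py; rewrite -[x]scale1r; exact: PL. Qed.

Lemma subspace_scale P c x : is_subspace P -> P x -> P (c *: x).
Proof. by move=> [P0 PL] Px; rewrite -[_ *: _]addr0; exact: PL. Qed.

Lemma subspace_sum P I (r : seq I) (Q : pred I) (F : I -> V) :
  is_subspace P -> (forall i, Q i -> P (F i)) -> P (\sum_(i <- r | Q i) F i).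
Proof.
by move=> sP PF; apply: big_ind => // [|x y]; [case: sP|exact: subspace_add].
Qed.

Lemma kspan_gen P x : P x -> kspan P x.
Proof.
move=> Px; exists 1%N, (fun=> 1), (fun=> x).
by split=> //; rewrite big_ord1 scale1r.
Qed.

Lemma kspan_min P Q : is_subspace Q -> (forall x, P x -> Q x) ->
  forall x, kspan P x -> Q x.
Proof.
move=> sQ PQ x [n [c [w [Pw ->]]]].
by apply: subspace_sum => // i _; apply: subspace_scale => //; exact: PQ.
Qed.

Lemma kspan_subspace P : is_subspace (kspan P).
Proof.
split=> [|d x y [m [b [u [Pu ->]]]] [n [c [w [Pw ->]]]]].
  exists 0%N, (fun=> 0), (fun=> 0).
  by split=> [[]|] //; rewrite big_ord0.
exists (m + n)%N,
  (fun i => match fintype.split i with inl i => d * b i | inr j => c j end),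
  (fun i => match fintype.split i with inl i => u i | inr j => w j end).
split=> [i|]; first by case: (fintype.split i).
rewrite big_split_ord scaler_sumr; congr (_ + _); apply: eq_bigr => i _.
  by rewrite (unsplitK (inl _ i)) scalerA.
by rewrite (unsplitK (inr _ i)).
Qed.

(** Applying [p n] to a vanishing sum of homogeneous elements isolates its term
    of degree [n]. *)
Lemma direct_sum_proj (Y : int -> V -> Prop) (p : int -> V -> V) :
  (forall n, is_subspace (Y n)) -> (forall n, linear (p n)) ->
  (forall m n x, Y m x -> p n x = if n == m then x else 0) ->
  (forall x, kspan (fun y => exists n, Y n y) x) -> is_direct_sum Y.
Proof.
move=> sY lp pY spanY; split=> [x|s y us Yy sum0 n sn].
  have [N [c [w [Yw ->]]]] := spanY x.
  have [d Yd] := choice Yw.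
  exists (undup (codom d)).
  exists (fun n => \sum_(i | d i == n) c i *: w i); split=> [n|].
    apply: subspace_sum => // i /eqP <-.
    exact: subspace_scale (sY _) (Yd i).
  under [RHS]eq_bigr do rewrite big_mkcond.
  rewrite exchange_big; apply: eq_bigr => i _.
  rewrite (bigD1_seq (d i)) ?undup_uniq ?mem_undup ?codom_f //=.
  by rewrite eqxx big1 ?addr0 // => n; rewrite eq_sym => /negbTE ->.
have := congr1 (p n) sum0; rewrite (linear_0 (lp n)) (linear_big (lp n)).
rewrite (bigD1_seq n) //= (pY n) // eqxx big1 ?addr0 // => m mn.
by rewrite (pY m) // eq_sym (negbTE mn).
Qed.
End Subspaces.

(** * Modules over a Leavitt path algebra *)

Section LeavittModules.
Variables (k : fieldType) (E : graph).

(** The defining relations of L_k(E), read as identities between operators;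
    [fam_one] makes the resulting module unital. *)
Record leavitt_family (V : lmodType k)
    (opv : vert E -> V -> V) (ope opg : edge E -> V -> V) : Prop := LeavittFamily {
  fam_linv : forall v, linear (opv v);
  fam_line : forall e, linear (ope e);
  fam_ling : forall e, linear (opg e);
  fam_vv : forall v u x, opv v (opv u x) = if v == u then opv v x else 0;
  fam_se : forall e x, opv (src e) (ope e x) = ope e x;
  fam_er : forall e x, ope e (opv (rng e) x) = ope e x;
  fam_re : forall e x, opv (rng e) (opg e x) = opg e x;
  fam_es : forall e x, opg e (opv (src e) x) = opg e x;
  fam_ee : forall e e' x,
    opg e (ope e' x) = if e == e' then opv (rng e) x else 0;
  fam_sum : forall v x, opv v x = \sum_(e | src e == v) ope e (opg e x);
  fam_one : forall x, \sum_v opv v x = x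
}.

Section FamilyAction.
Variables (V : lmodType k) (opv : vert E -> V -> V) (ope opg : edge E -> V -> V).
Hypothesis fam : leavitt_family opv ope opg.

Fixpoint lterm_act (t : lterm k E) : V -> V :=
  match t with
  | LVert v => opv v
  | LEdge e => ope e
  | LGhost e => opg e
  | LZero => fun=> 0
  | LAdd t u => fun x => lterm_act t x + lterm_act u x
  | LScale c t => fun x => c *: lterm_act t x
  | LMul t u => fun x => lterm_act t (lterm_act u x)
  end.

Definition leavitt_act (a : leavitt k E) : V -> V := lterm_act (repr a).

Lemma lterm_act_linear t : linear (lterm_act t).
Proof.
elim: t => [v|e|e||t IHt u IHu|c t IHt|t IHt u IHu] /=.
- exact: (fam_linv fam).
- exact: (fam_line fam).
- exact: (fam_ling fam).
- by move=> c x y; rewrite scaler0 addr0.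
- by move=> c x y; rewrite IHt IHu scalerDr addrACA.
- by move=> d x y; rewrite IHt scalerDr !scalerA mulrC.
- exact: linear_comp.
Qed.

Lemma lterm_act_cong t u : lcong t u -> lterm_act t =1 lterm_act u.
Proof.
elim=> {t u} //=.
- move=> t u [v w|e|e|e|e|e e'|v] x /=.
  + by rewrite (fam_vv fam); case: eqP.
  + exact: (fam_se fam).
  + exact: (fam_er fam).
  + exact: (fam_re fam).
  + exact: (fam_es fam).
  + by rewrite (fam_ee fam); case: eqP.
  + rewrite (fam_sum fam).
    by rewrite (big_morph (lterm_act^~ x) (id1 := 0) (op1 := +%R)).
- by move=> t u _ + x => ->.
- by move=> u t w _ + _ + x => -> ->.
- by move=> t t' u u' _ + _ + x => -> ->.
- by move=> c t t' _ + x => ->.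
- by move=> t t' u u' _ + _ + x => -> ->.
- by move=> t u w x; rewrite addrA.
- by move=> t u x; rewrite addrC.
- by move=> t x; rewrite add0r.
- by move=> c d t x; rewrite scalerA.
- by move=> t x; rewrite scale0r.
- by move=> t x; rewrite scale1r.
- by move=> c t u x; rewrite scalerDr.
- by move=> c d t x; rewrite scalerDl.
- by move=> t u w x; rewrite (linear_add (lterm_act_linear t)).
- by move=> c t u x; rewrite (linear_scale (lterm_act_linear t)).
Qed.

Lemma leavitt_act_pi t : leavitt_act (lpi t) =1 lterm_act t.
Proof. exact/lterm_act_cong/lrepr. Qed.

Lemma leavitt_act_vert v : leavitt_act (lvert k v) =1 opv v.
Proof. exact: leavitt_act_pi. Qed.
Lemma leavitt_act_edge e : leavitt_act (ledge k e) =1 ope e.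
Proof. exact: leavitt_act_pi. Qed.
Lemma leavitt_act_ghost e : leavitt_act (lghost k e) =1 opg e.
Proof. exact: leavitt_act_pi. Qed.

Lemma leavitt_act_lmod : is_lmod leavitt_act.
Proof.
have actD a b x : leavitt_act (a + b) x = leavitt_act a x + leavitt_act b x.
  have [t ->] := lpi_surj a; have [u ->] := lpi_surj b.
  by rewrite -lpi_add !leavitt_act_pi.
have actZ c a x : leavitt_act (c *: a) x = c *: leavitt_act a x.
  by have [t ->] := lpi_surj a; rewrite -lpi_scale !leavitt_act_pi.
have act1 x : leavitt_act 1 x = x.
  rewrite leavitt_oneE (big_morph (leavitt_act^~ x) (id1 := 0) (op1 := +%R)) //=.
    by under eq_bigr do rewrite leavitt_act_vert; exact: (fam_one fam).
  by rewrite -[0](scale0r 0) actZ scale0r.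
split=> //.
- move=> a b x; have [t ->] := lpi_surj a; have [u ->] := lpi_surj b.
  by rewrite -lpi_mul !leavitt_act_pi.
- by move=> a; exact: lterm_act_linear.
- by move=> c x; rewrite actZ act1.
Qed.
End FamilyAction.

Section ActionBasics.
Variables (V : lmodType k) (act : leavitt k E -> V -> V).
Hypothesis lmod_act : is_lmod act.

Lemma lmod_scale c a x : act (c *: a) x = c *: act a x.
Proof.
have [act1 actM _ _ actK] := lmod_act.
by rewrite -[a]mul1r leavitt_scaleAl actM actK mul1r.
Qed.

Lemma lmod_linear_l x : linear (act^~ x).
Proof.
have [_ _ actD _ _] := lmod_act.
by move=> c a b; rewrite actD lmod_scale.
Qed.

Lemma leavitt_stable (P : V -> Prop) :
  is_subspace P ->
  (forall v x, P x -> P (act (lvert k v) x)) ->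
  (forall e x, P x -> P (act (ledge k e) x)) ->
  (forall e x, P x -> P (act (lghost k e) x)) ->
  forall a x, P x -> P (act a x).
Proof.
have [_ actM actD _ _] := lmod_act.
move=> sP Pv Pe Pg a; have [t ->] := lpi_surj a.
elim: t => [v|e|e||t IHt u IHu|c t IHt|t IHt u IHu] x Px.
- exact: Pv.
- exact: Pe.
- exact: Pg.
- by rewrite (linear_0 (lmod_linear_l x)); case: sP.
- by rewrite lpi_add actD; apply: subspace_add; [|exact: IHt|exact: IHu].
- by rewrite lpi_scale lmod_scale; apply: subspace_scale => //; exact: IHt.
- by rewrite lpi_mul actM; apply/IHt/IHu.
Qed.

(** L_k(E)_d is spanned by products of generators whose degrees add up to d, so
    it is enough to know how much each generator shifts the index of Y. *)
Lemma leavitt_graded_action (Y : int -> V -> Prop) :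
  (forall n, is_subspace (Y n)) ->
  (forall v n x, Y n x -> Y n (act (lvert k v) x)) ->
  (forall e n x, Y n x -> Y (n + 1) (act (ledge k e) x)) ->
  (forall e n x, Y n x -> Y (n - 1) (act (lghost k e) x)) ->
  forall d n a x, leavitt_deg d a -> Y n x -> Y (n + d) (act a x).
Proof.
have [act1 actM _ _ _] := lmod_act.
move=> sY Yv Ye Yg d n a x da Yx; move: a da.
apply: kspan_min; first exact: preim_subspace (lmod_linear_l x) _ (sY _).
move=> _ [v [w [p [q [_ _ <- ->]]]]].
rewrite actM /path_elt /path_ghost !actM addrCA addrC.
apply: (Yv).
have {Yx} : Y n (act (lvert k w) x) by exact: Yv.
move: (act (lvert k w) x) => {}x Yx.
have {Yx} : Y (n - (size q)%:Z) (act (\prod_(e <- rev q) lghost k e) x).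
  rewrite -(size_rev q); elim: (rev q) n x Yx => [|e r IH] m x Yx.
    by rewrite big_nil act1 subr0.
  rewrite big_cons actM /= -addn1 PoszD opprD addrA.
  exact/Yg/IH.
move: (act _ x) (n - _) => {}x {}n Yx; elim: p => [|e p IH].
  by rewrite big_nil act1 addr0.
by rewrite big_cons actM /= -addn1 PoszD addrA; apply/Ye/IH.
Qed.
End ActionBasics.

(** Uniqueness of an action with given generators is the case of the identity
    map; that the action commutes with another operator is the case of this
    operator. *)
Lemma leavitt_intertwine (V W : lmodType k) (aV : leavitt k E -> V -> V)
    (aW : leavitt k E -> W -> W) (h : V -> W) :
  is_lmod aV -> is_lmod aW -> linear h ->
  (forall v x, h (aV (lvert k v) x) = aW (lvert k v) (h x)) ->
  (forall e x, h (aV (ledge k e) x) = aW (ledge k e) (h x)) ->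
  (forall e x, h (aV (lghost k e) x) = aW (lghost k e) (h x)) ->
  forall a x, h (aV a x) = aW a (h x).
Proof.
move=> lV lW lh hv he hg a; have [t ->] := lpi_surj a.
have [_ VM VD _ _] := lV; have [_ WM WD _ _] := lW.
elim: t => [v|e|e||t IHt u IHu|c t IHt|t IHt u IHu] x.
- exact: hv.
- exact: he.
- exact: hg.
- rewrite (linear_0 (lmod_linear_l lV x)) (linear_0 lh).
  by rewrite (linear_0 (lmod_linear_l lW (h x))).
- by rewrite lpi_add VD WD (linear_add lh) IHt IHu.
- by rewrite lpi_scale !lmod_scale // (linear_scale lh) IHt.
- by rewrite lpi_mul VM WM IHt IHu.
Qed.

(** * The grading of a Leavitt path algebra *)

Lemma leavitt_regular_lmod :
  is_lmod (fun a S : leavitt k E => a * S).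
Proof.
split=> [x|a b x|a b x|a c x y|c x].
- by rewrite mul1r.
- by rewrite mulrA.
- by rewrite mulrDl.
- by rewrite mulrDr leavitt_scaleAr.
- by rewrite -leavitt_scaleAl mul1r.
Qed.

Lemma leavitt_mul_linear_l (S : leavitt k E) : linear (fun T : leavitt k E => S * T).
Proof. by have [_ _ _] := leavitt_regular_lmod. Qed.

Lemma leavitt_deg_subspace n : is_subspace (@leavitt_deg k E n).
Proof. exact: kspan_subspace. Qed.

Lemma leavitt_deg_vert v : leavitt_deg 0 (lvert k v : leavitt k E).
Proof.
apply: kspan_gen; exists v, v, [::], [::]; split=> //.
by rewrite /path_elt /path_ghost /= !big_nil mulr1 mul1r lvM eqxx.
Qed.

Lemma leavitt_deg1 : leavitt_deg 0 (1 : leavitt k E).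
Proof.
rewrite leavitt_oneE; apply: subspace_sum => [|v _].
  exact: leavitt_deg_subspace.
exact: leavitt_deg_vert.
Qed.

Lemma is_path_rcons (e : edge E) w q :
  is_path w (rcons q e) =
  is_path w q && (src e == last w [seq rng f | f <- q]).
Proof.
elim: q w => [|g q IH] w /=; first by rewrite andbT.
by rewrite IH andbA.
Qed.

Lemma leavitt_deg_mull a m n :
  (forall v w p q, is_path v p -> is_path w q -> (size p)%:Z - (size q)%:Z = n ->
    leavitt_deg m (a * path_elt k v p * path_ghost k w q : leavitt k E)) ->
  forall S : leavitt k E, leavitt_deg n S -> leavitt_deg m (a * S).
Proof.
move=> aP; apply: kspan_min => [|_ [v [w [p [q [pp pq pqn ->]]]]]].
  exact: preim_subspace (leavitt_mul_linear_l a) _ (leavitt_deg_subspace m).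
by rewrite mulrA; exact: aP.
Qed.

Lemma leavitt_deg_lvert v n S :
  leavitt_deg n S -> leavitt_deg n (lvert k v * S : leavitt k E).
Proof.
apply: leavitt_deg_mull S => v' w p q pp pq pqn.
rewrite /path_elt !mulrA lvM; case: eqP => [->|_]; last first.
  by rewrite !mul0r; case: (leavitt_deg_subspace n).
by apply: kspan_gen; exists v', w, p, q; split; rewrite // mulrA.
Qed.

Lemma leavitt_deg_ledge e n S :
  leavitt_deg n S -> leavitt_deg (n + 1) (ledge k e * S : leavitt k E).
Proof.
apply: leavitt_deg_mull S => v w p q pp pq <-.
have deg0 m : leavitt_deg m (0 : leavitt k E) by case: (leavitt_deg_subspace m).
rewrite /path_elt -(le_rng k e) !mulrA -[_ * lvert k v]mulrA lvM.
case: eqP => [rv|_]; last by rewrite !(mul0r, mulr0).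
apply: kspan_gen; exists (src e), w, (e :: p), q; split=> //=.
- by rewrite eqxx rv.
- by rewrite -addn1 PoszD addrAC.
- by rewrite /path_elt big_cons !mulrA src_le le_rng.
Qed.

(** On a monomial p q^* with p of positive length, e^* either cancels the first
    edge of p or gives zero. If p is a vertex, then e^* q^* is the ghost of the
    path q followed by e, or zero if these two cannot be composed. *)
Lemma leavitt_deg_lghost e n S :
  leavitt_deg n S -> leavitt_deg (n - 1) (lghost k e * S : leavitt k E).
Proof.
apply: leavitt_deg_mull S => v w p q pp pq <-.
have deg0 m : leavitt_deg m (0 : leavitt k E) by case: (leavitt_deg_subspace m).
rewrite /path_elt /path_ghost -{1}(ls_src k e) !mulrA -[_ * lvert _ v]mulrA lvM.
case: eqP => [sv|_]; last by rewrite mulr0 !mul0r.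
rewrite ls_src; case: p pp => [_|f p /= /andP[/eqP sf pf]]; last first.
  rewrite big_cons !mulrA ls_le; case: eqP => [ef|_]; last by rewrite !mul0r.
  apply: kspan_gen; exists (rng e), w, p, q; split=> //=.
  - by rewrite ef.
  - by rewrite -addn1 PoszD -!addrA [1 + _]addrCA subrr addr0.
  - by rewrite /path_elt /path_ghost !mulrA.
rewrite big_nil mulr1.
have [qe|qe] := eqVneq (src e) (last w [seq rng f | f <- q]).
  apply: kspan_gen; exists (rng e), w, [::], (rcons q e); split=> //.
  - by rewrite is_path_rcons pq qe eqxx.
  - by rewrite size_rcons -addn1 PoszD opprD addrA.
  - rewrite /path_elt /path_ghost big_nil mulr1 rev_rcons big_cons !mulrA.
    by rewrite rng_ls.
suff -> : lghost k e * (\prod_(e0 <- rev q) lghost k e0) * lvert k w = 0 by [].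
case/lastP: q pq qe => [_|q g _] /=.
  rewrite big_nil mulr1 => sw.
  by rewrite -(ls_src k e) -mulrA lvM (negbTE sw) mulr0.
rewrite map_rcons last_rcons rev_rcons big_cons -(rng_ls k g) -(ls_src k e) => sw.
by rewrite !mulrA -[_ * lvert _ (src e) * _]mulrA lvM (negbTE sw) mulr0 !mul0r.
Qed.

Lemma leavitt_degM m n S T : leavitt_deg m S -> leavitt_deg n T ->
  leavitt_deg (m + n) (S * T : leavitt k E).
Proof.
rewrite addrC.
apply: (leavitt_graded_action leavitt_regular_lmod leavitt_deg_subspace).
- by move=> v d x; exact: leavitt_deg_lvert.
- by move=> e d x; exact: leavitt_deg_ledge.
- by move=> e d x; exact: leavitt_deg_lghost.
Qed.

Lemma leavitt_deg_span (S : leavitt k E) :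
  kspan (fun T => exists n, leavitt_deg n T) S.
Proof.
pose Q := kspan (fun T : leavitt k E => exists n, leavitt_deg n T).
have sQ : is_subspace Q by exact: kspan_subspace.
have QM a : (forall n T, leavitt_deg n T -> Q (a * T)) -> forall T, Q T -> Q (a * T).
  move=> Qa; apply: kspan_min => [|T [n Tn]]; last exact: Qa Tn.
  exact: preim_subspace (leavitt_mul_linear_l a) _ sQ.
rewrite -[S]mulr1; apply: (leavitt_stable leavitt_regular_lmod sQ).
- move=> v; apply: QM => n T Tn; apply: kspan_gen; exists n.
  exact: leavitt_deg_lvert.
- move=> e; apply: QM => n T Tn; apply: kspan_gen; exists (n + 1).
  exact: leavitt_deg_ledge.
- move=> e; apply: QM => n T Tn; apply: kspan_gen; exists (n - 1).
  exact: leavitt_deg_lghost.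
- by apply: kspan_gen; exists 0; exact: leavitt_deg1.
Qed.

(** Writing the sequence phi as the formal series in t and t^-1 with
    coefficients phi n, these are the left multiplications by v, by e t and by
    e^* t^-1. They satisfy the defining relations because t is central and
    invertible. *)
Definition shift_vert (v : vert E) (phi : int -> leavitt k E) :=
  (fun n => lvert k v * phi n) : int -> leavitt k E.
Definition shift_edge (e : edge E) (phi : int -> leavitt k E) :=
  (fun n => ledge k e * phi (n - 1)) : int -> leavitt k E.
Definition shift_ghost (e : edge E) (phi : int -> leavitt k E) :=
  (fun n => lghost k e * phi (n + 1)) : int -> leavitt k E.

Lemma shift_family : leavitt_family shift_vert shift_edge shift_ghost.
Proof.
rewrite /shift_vert /shift_edge /shift_ghost.
split=> [v c x y|e c x y|e c x y|v u x|e x|e x|e x|e x|e e' x|v x|x];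
  apply/funext => n /=.
- exact: leavitt_mul_linear_l.
- exact: leavitt_mul_linear_l.
- exact: leavitt_mul_linear_l.
- by rewrite mulrA lvM; case: eqP => // _; rewrite mul0r.
- by rewrite mulrA src_le.
- by rewrite mulrA le_rng.
- by rewrite mulrA rng_ls.
- by rewrite mulrA ls_src.
- by rewrite mulrA ls_le addrK; case: eqP => // _; rewrite mul0r.
- rewrite lv_sum mulr_suml fct_sumE; apply: eq_bigr => e _.
  by rewrite mulrA subrK.
- by rewrite fct_sumE -mulr_suml -leavitt_oneE mul1r.
Qed.

Definition shift_act := leavitt_act shift_vert shift_edge shift_ghost.

Lemma shift_act_lmod : is_lmod shift_act.
Proof. exact: leavitt_act_lmod shift_family. Qed.

(** The coefficient of t^n in the image of the constant series 1 under S. *)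
Definition leavitt_proj (n : int) (S : leavitt k E) : leavitt k E :=
  shift_act S (fun m => if m == 0 then 1 else 0) n.

Lemma leavitt_proj_linear n : linear (leavitt_proj n).
Proof. by move=> c S T; rewrite /leavitt_proj (lmod_linear_l shift_act_lmod). Qed.

Lemma leavitt_proj_vemb n a S : leavitt_proj n (vemb a * S) = vemb a * leavitt_proj n S.
Proof.
have [_ actM _ _ _] := shift_act_lmod.
rewrite /leavitt_proj actM /vemb (linear_big (lmod_linear_l shift_act_lmod _)).
rewrite fct_sumE mulr_suml; apply: eq_bigr => v _.
rewrite (lmod_scale shift_act_lmod) -leavitt_scaleAl.
by rewrite /shift_act (leavitt_act_vert shift_family).
Qed.

(** On series, S of degree d is the left multiplication by S t^d. The elements
    S with this property, for varying d, are moved by the generators as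
    [leavitt_graded_action] requires, and 1 is one of them with d = 0. *)
Lemma shift_act_deg d S phi n :
  leavitt_deg d S -> shift_act S phi n = S * phi (n - d).
Proof.
have [_ actM _ _ _] := shift_act_lmod.
pose Y d (S : leavitt k E) :=
  forall phi n, shift_act S phi n = S * phi (n - d).
move=> Sd; suff YS : Y d S by exact: YS.
rewrite -[d]add0r -[S]mulr1.
apply: (leavitt_graded_action leavitt_regular_lmod (Y := Y)) Sd _ => //.
- move=> m; split=> [psi i|c x y xY yY psi i].
    by rewrite (linear_0 (lmod_linear_l shift_act_lmod _)) mul0r.
  by rewrite (lmod_linear_l shift_act_lmod) mulrDl -leavitt_scaleAl -xY -yY.
- move=> v m x xY psi i; rewrite actM /shift_act.
  by rewrite (leavitt_act_vert shift_family) /shift_vert -mulrA -xY.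
- move=> e m x xY psi i; rewrite actM /shift_act.
  rewrite (leavitt_act_edge shift_family) /shift_edge -mulrA.
  by rewrite opprD addrCA addrC -xY.
- move=> e m x xY psi i; rewrite actM /shift_act.
  rewrite (leavitt_act_ghost shift_family) /shift_ghost -mulrA.
  by rewrite opprB addrA -xY.
- by move=> psi i; have [act1 _ _ _ _] := shift_act_lmod; rewrite act1 subr0 mul1r.
Qed.

Lemma leavitt_proj_deg d n S :
  leavitt_deg d S -> leavitt_proj n S = if n == d then S else 0.
Proof.
move=> Sd; rewrite /leavitt_proj (shift_act_deg _ _ Sd) subr_eq0.
by case: eqP => _; rewrite ?mulr1 ?mulr0.
Qed.

End LeavittModules.

(** * Maps out of a tensor product *)

Section TensorMaps.
Variables (k : fieldType) (A B C : kAlgType k) (X : bimod A B) (Y : bimod B C).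

Lemma tpure_linear_l (y : Y) : linear (fun x : X => tpure x y).
Proof. exact: tensor_pure_linl. Qed.

Lemma tpure_linear_r (x : X) : linear (fun y : Y => tpure x y).
Proof. exact: tensor_pure_linr. Qed.

Lemma tpure_bal (x : X) b (y : Y) : tpure (ract X x b) y = tpure x (lact Y b y).
Proof. exact: tensor_pure_bal. Qed.

Lemma lact_tpure a (x : X) (y : Y) :
  lact (tensor X Y) a (tpure x y) = tpure (lact X a x) y.
Proof. exact: tensor_lactE. Qed.

Lemma ract_tpure (x : X) (y : Y) c :
  ract (tensor X Y) (tpure x y) c = tpure x (ract Y y c).
Proof. exact: tensor_ractE. Qed.

Lemma tensor_ext (V : lmodType k) (f g : tensor X Y -> V) :
  linear f -> linear g -> (forall x y, f (tpure x y) = g (tpure x y)) -> f =1 g.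
Proof.
move=> lf lg fg; apply: tensor_ind => [|c z w fz fw|x y]; last exact: fg.
  by rewrite (linear_0 lf) (linear_0 lg).
by rewrite lf lg fz fw.
Qed.

Lemma tensor_sum_tpure (z : tensor X Y) :
  exists (n : nat) (x_ : 'I_n -> X) (y_ : 'I_n -> Y),
    z = \sum_(i < n) tpure (x_ i) (y_ i).
Proof.
have : kspan (fun z : tensor X Y => exists p, z = tpure p.1 p.2) z.
  apply: tensor_ind z => [|c z w|x y].
  - by case: (kspan_subspace (fun z : tensor X Y => exists p, z = tpure p.1 p.2)).
  - case: (kspan_subspace (fun z : tensor X Y => exists p, z = tpure p.1 p.2)).
    by move=> _; apply.
  - by apply: kspan_gen; exists (x, y).
move=> [n [c [w [/choice[p wp] ->]]]].
exists n, (fun i => c i *: (p i).1), (fun i => (p i).2).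
by apply: eq_bigr => i _; rewrite (linear_scale (tpure_linear_l _)) wp.
Qed.

Section Lift.
Variables (V : lmodType k) (f : X -> Y -> V).

Record balanced : Prop := Balanced {
  bal_linear_l : forall y, linear (f^~ y);
  bal_linear_r : forall x, linear (f x);
  bal_mid : forall x b y, f (ract X x b) y = f x (lact Y b y)
}.

Definition tlift : tensor X Y -> V := mlift (fun p => f p.1 p.2).

Hypothesis balf : balanced.

Let tlift_rel t u : tensor_rel t u ->
  mtermE (fun p => f p.1 p.2) t = mtermE (fun p => f p.1 p.2) u.
Proof.
case=> [c x x' y|c x y y'|x b y] /=.
- exact: (bal_linear_l balf).
- exact: (bal_linear_r balf).
- exact: (bal_mid balf).
Qed.

Lemma tlift_linear : linear tlift.
Proof. exact: (mliftP tlift_rel).1. Qed.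

Lemma tlift_tpure x y : tlift (tpure x y) = f x y.
Proof. exact: ((mliftP tlift_rel).2 (x, y)). Qed.
End Lift.
End TensorMaps.

Section BimodBasics.
Variables (k : fieldType) (A B : kAlgType k) (X : bimod A B).

Lemma lact_linear a : linear (lact X a).
Proof. by have [[_ _ _ P _] _ _] := bimodP X; exact: P. Qed.
Lemma ract_linear b : linear (fun x => ract X x b).
Proof. by have [_ [_ _ _ P _] _] := bimodP X; exact: P. Qed.
Lemma lactM a b x : lact X (a * b) x = lact X a (lact X b x).
Proof. by have [[_ P _ _ _] _ _] := bimodP X; exact: P. Qed.
Lemma lactD a b x : lact X (a + b) x = lact X a x + lact X b x.
Proof. by have [[_ _ P _ _] _ _] := bimodP X; exact: P. Qed.
Lemma lact1 x : lact X 1 x = x.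
Proof. by have [[P _ _ _ _] _ _] := bimodP X; exact: P. Qed.
Lemma lact_ract a x b : lact X a (ract X x b) = ract X (lact X a x) b.
Proof. by have [_ _ P] := bimodP X; exact: P. Qed.

Lemma lact0 x : lact X 0 x = 0.
Proof. by apply: (addIr (lact X 0 x)); rewrite -lactD !add0r. Qed.
End BimodBasics.

Lemma iso_inv_linear (k : fieldType) (A B : kAlgType k) (X Y : bimod A B)
  (s : bimod_iso X Y) : linear (iso_inv s).
Proof.
move=> c x y; apply: (can_inj (iso_mapK s)).
by rewrite (iso_linear s) !iso_invK.
Qed.

Lemma iso_inv_lact (k : fieldType) (A B : kAlgType k) (X Y : bimod A B)
  (s : bimod_iso X Y) a y : iso_inv s (lact Y a y) = lact X a (iso_inv s y).
Proof. by apply: (can_inj (iso_mapK s)); rewrite iso_lact !iso_invK. Qed.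

Lemma iso_inv_ract (k : fieldType) (A B : kAlgType k) (X Y : bimod A B)
  (s : bimod_iso X Y) y b : iso_inv s (ract Y y b) = ract X (iso_inv s y) b.
Proof. by apply: (can_inj (iso_mapK s)); rewrite iso_ract !iso_invK. Qed.

(** * The algebra kE^0 and the bimodule kE^1 *)

Section VertexEdge.
Variables (k : fieldType) (E : graph).

Lemma kE0_scale (c : k) (a : kE0 k E) : c *: a = kmap (kE0 k E) c * a.
Proof. by apply/ffunP => v; rewrite !ffunE -scalerAl mul1r. Qed.

Lemma vtx_expand (a : kE0 k E) : a = \sum_v a v *: vtx k v.
Proof.
apply/ffunP => v; rewrite sum_ffunE (bigD1 v) //= !ffunE eqxx.
rewrite [_ *: _]mulr1 big1 ?addr0 // => u; rewrite !ffunE eq_sym => /negbTE ->.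
exact: mulr0.
Qed.

Lemma vtxM u v : vtx k u * vtx k v = if u == v then vtx k u else 0 :> kE0 k E.
Proof.
apply/ffunP => w; case: eqVneq => [->|uv]; rewrite !ffunE.
  by case: eqP; rewrite ?mulr1 ?mulr0.
by case: eqVneq => [->|_]; rewrite ?mul0r // (negbTE uv) mulr0.
Qed.

Lemma vtx_sum : 1 = \sum_v vtx k v :> kE0 k E.
Proof.
rewrite [LHS]vtx_expand; apply: eq_bigr => v _.
by rewrite ffunE scale1r.
Qed.

Lemma lact_vtx_edg v (e : edge E) :
  lact (kE1 k E) (vtx k v) (edg k e) = if src e == v then edg k e else 0.
Proof.
apply/ffunP => g; rewrite !ffunE; case: (eqVneq g e) => [->|ge].
  by rewrite mulr1; case: eqP; rewrite ffunE ?eqxx.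
by rewrite mulr0; case: eqP => _; rewrite ffunE ?(negbTE ge).
Qed.

Lemma ract_edg_rng (e : edge E) a :
  ract (kE1 k E) (edg k e) a = (a (rng e) : k) *: edg k e.
Proof.
apply/ffunP => g; rewrite !ffunE; case: (eqVneq g e) => [->|_].
  by rewrite mul1r [RHS]mulr1.
by rewrite mul0r [RHS]mulr0.
Qed.

Lemma edg_expand (y : kE1 k E) : y = \sum_e (y : kE1_space k E) e *: edg k e.
Proof.
apply/ffunP => g; rewrite sum_ffunE (bigD1 g) //= !ffunE eqxx.
rewrite [_ *: _]mulr1 big1 ?addr0 // => u; rewrite !ffunE eq_sym => /negbTE ->.
exact: mulr0.
Qed.

Lemma eemb_linear : linear (@eemb k E).
Proof.
move=> c y z; rewrite /eemb scaler_sumr -big_split; apply: eq_bigr => e _.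
by rewrite !ffunE scalerDl scalerA.
Qed.

Lemma eemb_edg (e : edge E) : eemb (edg k e) = ledge k e.
Proof.
rewrite /eemb (bigD1 e) //= ffunE eqxx scale1r big1 ?addr0 // => g ge.
by rewrite ffunE (negbTE ge) scale0r.
Qed.

Lemma vemb_ledge (a : kE0 k E) e : vemb a * ledge k e = (a (src e) : k) *: ledge k e.
Proof.
rewrite /vemb mulr_suml (bigD1 (src e)) //= -leavitt_scaleAl src_le.
rewrite big1 ?addr0 // => v vs.
by rewrite -leavitt_scaleAl -(src_le k e) mulrA lvM (negbTE vs) mul0r scaler0.
Qed.

Lemma ledge_vemb (a : kE0 k E) e : ledge k e * vemb a = (a (rng e) : k) *: ledge k e.
Proof.
rewrite /vemb mulr_sumr (bigD1 (rng e)) //= -leavitt_scaleAr le_rng.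
rewrite big1 ?addr0 // => v vs.
rewrite -leavitt_scaleAr -(le_rng k e) -mulrA lvM eq_sym (negbTE vs).
by rewrite mulr0 scaler0.
Qed.

Lemma lghost_vemb (a : kE0 k E) e : lghost k e * vemb a = (a (src e) : k) *: lghost k e.
Proof.
rewrite /vemb mulr_sumr (bigD1 (src e)) //= -leavitt_scaleAr ls_src.
rewrite big1 ?addr0 // => v vs.
rewrite -leavitt_scaleAr -(ls_src k e) -mulrA lvM eq_sym (negbTE vs).
by rewrite mulr0 scaler0.
Qed.

Lemma eemb_ract y (a : kE0 k E) : eemb (ract (kE1 k E) y a) = eemb y * vemb a.
Proof.
rewrite {2}/eemb mulr_suml; apply: eq_bigr => e _.
by rewrite -leavitt_scaleAl ledge_vemb scalerA ffunE.
Qed.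

Lemma lghost_eemb e (y : kE1 k E) :
  lghost k e * eemb y = ((y : kE1_space k E) e : k) *: lvert k (rng e).
Proof.
rewrite -ghost_mulE /ghost_mul (linear_scale (@vemb_linear k E)).
by rewrite vemb_vtx.
Qed.

Lemma ghost_mul_linear (e : edge E) : linear (ghost_mul (k := k) e).
Proof. by move=> c y z; rewrite /ghost_mul !ffunE scalerDl scalerA. Qed.

Lemma ghost_mul_ract e y (a : kE0 k E) :
  ghost_mul e (ract (kE1 k E) y a) = ghost_mul e y * a.
Proof.
apply/ffunP => v; rewrite !ffunE; case: eqVneq => [->|_].
  by rewrite ![_ *: _]mulr1.
by rewrite ![_ *: _]mulr0 mul0r.
Qed.

Lemma ghost_mul_lact_src e (y : kE1 k E) :
  ghost_mul e (lact (kE1 k E) (vtx k (src e)) y) = ghost_mul e y.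
Proof. by rewrite /ghost_mul !ffunE eqxx mul1r. Qed.

Lemma vtx_ghost_mul e (y : kE1 k E) : vtx k (rng e) * ghost_mul e y = ghost_mul e y.
Proof.
apply/ffunP => v; rewrite !ffunE; case: eqP => _; first by rewrite mul1r.
by rewrite mul0r [RHS]mulr0.
Qed.
End VertexEdge.

Lemma lact_linear_l (k : fieldType) (E : graph) (B : kAlgType k)
  (X : bimod (kE0 k E) B) (x : X) : linear (fun a : kE0 k E => lact X a x).
Proof.
have [[_ _ _ _ XK] _ _] := bimodP X.
by move=> c a b; rewrite lactD kE0_scale lactM XK.
Qed.

Lemma sum_edge_ghost (k : fieldType) (F : graph) :
  \sum_f ledge k f * lghost k f = 1 :> leavitt k F.
Proof.
rewrite leavitt_oneE (partition_big src xpredT) //=.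
by apply: eq_bigr => v _; rewrite lv_sum.
Qed.

(** * The operators on M (x) L_k(F) *)

Section Operators.
Variables (k : fieldType) (E F : graph) (M : bimod (kE0 k E) (kE0 k F)).
Implicit Types (m : M) (S T : leavitt k F).

Lemma mlf_linear_l S : linear (fun m => mlf m S).
Proof. exact: tpure_linear_l. Qed.

Lemma mlf_linear_r m : linear (fun S => mlf m S).
Proof. exact: (@tpure_linear_r _ _ _ _ M (leavitt_bimod k F)). Qed.

Lemma mlf_bal m a S : mlf (ract M m a) S = mlf m (vemb a * S).
Proof. exact: (@tpure_bal _ _ _ _ M (leavitt_bimod k F)). Qed.

Lemma lact_mlf a m S : lact (MLF M) a (mlf m S) = mlf (lact M a m) S.
Proof. exact: (@lact_tpure _ _ _ _ M (leavitt_bimod k F)). Qed.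

Lemma ract_mlf m S T : ract (MLF M) (mlf m S) T = mlf m (S * T).
Proof. exact: (@ract_tpure _ _ _ _ M (leavitt_bimod k F)). Qed.

Lemma mlf_ext (V : lmodType k) (f g : MLF M -> V) :
  linear f -> linear g -> (forall m S, f (mlf m S) = g (mlf m S)) -> f =1 g.
Proof. exact: tensor_ext. Qed.

(** The passage from M (x) kF^1 to M (x) L_k(F) that ends the action of an
    edge: S is the second factor of the tensor acted upon. *)
Definition absorb S : tensor M (kE1 k F) -> MLF M :=
  tlift (fun m (y : kE1 k F) => mlf m (eemb y * S)).

Lemma absorb_balanced S : balanced (fun m (y : kE1 k F) => mlf m (eemb y * S)).
Proof.
split=> [y|m|m b y]; first exact: mlf_linear_l.
  apply: (linear_comp (mlf_linear_r m)).
  by move=> c y z; rewrite eemb_linear mulrDl leavitt_scaleAl.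
rewrite mlf_bal mulrA; congr (mlf m (_ * S)).
rewrite /eemb mulr_sumr; apply: eq_bigr => f _.
by rewrite -leavitt_scaleAr vemb_ledge scalerA ffunE mulrC.
Qed.

Lemma absorb_tpure S m (y : kE1 k F) : absorb S (tpure m y) = mlf m (eemb y * S).
Proof. exact: (tlift_tpure (absorb_balanced S)). Qed.

Lemma absorb_linear S : linear (absorb S).
Proof. exact: (tlift_linear (absorb_balanced S)). Qed.

Lemma absorb_linear_r z : linear (fun S => absorb S z).
Proof.
move=> c S T; have [n [m_ [y_ ->]]] := tensor_sum_tpure z.
rewrite !(linear_big (absorb_linear _)) scaler_sumr -big_split.
apply: eq_bigr => i _; rewrite /= !absorb_tpure mulrDr -leavitt_scaleAr.
exact: mlf_linear_r.
Qed.

Lemma absorb_lact S a z :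
  absorb S (lact (tensor M (kE1 k F)) a z) = lact (MLF M) a (absorb S z).
Proof.
move: z; apply: tensor_ext => [||m y].
- exact: linear_comp (absorb_linear S) (lact_linear a).
- exact: linear_comp (lact_linear a) (absorb_linear S).
- by rewrite lact_tpure !absorb_tpure lact_mlf.
Qed.

Lemma absorb_ract S b z :
  absorb S (ract (tensor M (kE1 k F)) z b) = absorb (vemb b * S) z.
Proof.
move: z; apply: tensor_ext => [||m y].
- exact: linear_comp (absorb_linear S) (ract_linear b).
- exact: absorb_linear.
- by rewrite ract_tpure !absorb_tpure eemb_ract mulrA.
Qed.

Lemma ract_absorb S T z : ract (MLF M) (absorb S z) T = absorb (S * T) z.
Proof.
move: z; apply: tensor_ext => [||m y].
- exact: linear_comp (ract_linear T) (absorb_linear S).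
- exact: absorb_linear.
- by rewrite !absorb_tpure ract_mlf mulrA.
Qed.

Lemma absorb_sum_ghost m S :
  \sum_f absorb (lghost k f * S) (tpure m (edg k f)) = mlf m S.
Proof.
under eq_bigr do rewrite absorb_tpure eemb_edg mulrA.
by rewrite -(linear_big (mlf_linear_r m)) -mulr_suml sum_edge_ghost mul1r.
Qed.

(** As e^* y is the e-coordinate of y times r(e), this is the contraction with
    the element of the dual basis of E^1 at e. *)
Definition strip (e : edge E) : tensor (kE1 k E) M -> M :=
  tlift (fun (y : kE1 k E) m => lact M (ghost_mul e y) m).

Lemma strip_balanced (e : edge E) :
  balanced (fun (y : kE1 k E) m => lact M (ghost_mul e y) m).
Proof.
split=> [m|y|y b m]; last by rewrite ghost_mul_ract lactM.
  exact: linear_comp (lact_linear_l m) (@ghost_mul_linear k E e).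
exact: lact_linear.
Qed.

Lemma strip_tpure e (y : kE1 k E) m : strip e (tpure y m) = lact M (ghost_mul e y) m.
Proof. exact: (tlift_tpure (strip_balanced e)). Qed.

Lemma strip_linear e : linear (strip e).
Proof. exact: (tlift_linear (strip_balanced e)). Qed.

Lemma strip_edg e e' m :
  strip e (tpure (edg k e') m) = if e == e' then lact M (vtx k (rng e)) m else 0.
Proof.
rewrite strip_tpure /ghost_mul ffunE; case: eqP => _; first by rewrite scale1r.
by rewrite scale0r lact0.
Qed.

Lemma strip_lact_src e z :
  strip e (lact (tensor (kE1 k E) M) (vtx k (src e)) z) = strip e z.
Proof.
move: z; apply: tensor_ext => [||y m].
- exact: linear_comp (strip_linear e) (lact_linear _).
- exact: strip_linear.
- by rewrite lact_tpure !strip_tpure ghost_mul_lact_src.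
Qed.

Lemma lact_strip_rng e z : lact M (vtx k (rng e)) (strip e z) = strip e z.
Proof.
move: z; apply: tensor_ext => [||y m].
- exact: linear_comp (lact_linear _) (strip_linear e).
- exact: strip_linear.
- by rewrite !strip_tpure -lactM vtx_ghost_mul.
Qed.

Lemma strip_ract e z b :
  strip e (ract (tensor (kE1 k E) M) z b) = ract M (strip e z) b.
Proof.
move: z; apply: tensor_ext => [||y m].
- exact: linear_comp (strip_linear e) (ract_linear _).
- exact: linear_comp (ract_linear _) (strip_linear e).
- by rewrite ract_tpure !strip_tpure lact_ract.
Qed.

(** Expansion in the basis E^1 and its dual; the relation expressing v as the
    sum of the e e^* over the edges e leaving v comes from here. *)
Lemma sum_edg_strip v (z : tensor (kE1 k E) M) :
  \sum_(e | src e == v) tpure (edg k e) (strip e z) =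
  lact (tensor (kE1 k E) M) (vtx k v) z.
Proof.
move: z; apply: tensor_ext => [||y m].
- apply: linear_pointwise_sum => e.
  exact: linear_comp (tpure_linear_r _) (strip_linear e).
- exact: lact_linear.
rewrite lact_tpure {2}[y]edg_expand (linear_big (lact_linear _)).
rewrite (linear_big (tpure_linear_l _)) big_mkcond; apply: eq_bigr => e _.
rewrite (linear_scale (lact_linear _)) lact_vtx_edg.
case: eqP => _; last first.
  by rewrite scaler0 (linear_0 (tpure_linear_l m)).
rewrite strip_tpure -tpure_bal ract_edg_rng !ffunE eqxx.
by rewrite [_ *: 1%:R]mulr1.
Qed.

Variable sigma : bimod_iso (tensor (kE1 k E) M) (tensor M (kE1 k F)).

Definition vert_op (v : vert E) : MLF M -> MLF M := lact (MLF M) (vtx k v).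

Definition edge_map e m S : MLF M := absorb S (sigma (tpure (edg k e) m)).

Definition ghost_map e m S : MLF M :=
  \sum_f mlf (strip e (iso_inv sigma (tpure m (edg k f)))) (lghost k f * S).

Definition edge_op (e : edge E) : MLF M -> MLF M :=
  @tlift _ _ _ _ M (leavitt_bimod k F) _ (edge_map e).

Definition ghost_op (e : edge E) : MLF M -> MLF M :=
  @tlift _ _ _ _ M (leavitt_bimod k F) _ (ghost_map e).

Lemma edge_map_balanced e :
  @balanced _ _ _ _ M (leavitt_bimod k F) _ (edge_map e).
Proof.
split=> [S|m|m b S].
- apply: linear_comp (absorb_linear S) _.
  exact: linear_comp (iso_linear sigma) (tpure_linear_r _).
- exact: absorb_linear_r.
- by rewrite /edge_map -ract_tpure iso_ract absorb_ract.
Qed.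

Lemma ghost_map_balanced e :
  @balanced _ _ _ _ M (leavitt_bimod k F) _ (ghost_map e).
Proof.
split=> [S|m|m b S].
- apply: linear_pointwise_sum => f; apply: linear_comp (mlf_linear_l _) _.
  apply: linear_comp (strip_linear e) _.
  exact: linear_comp (iso_inv_linear sigma) (tpure_linear_l _).
- apply: linear_pointwise_sum => f; apply: linear_comp (mlf_linear_r _) _.
  exact: leavitt_mul_linear_l.
- apply: eq_bigr => f _; rewrite tpure_bal mulrA lghost_vemb -leavitt_scaleAl.
  have -> : lact (kE1 k F) b (edg k f) = (b (src f) : k) *: edg k f.
    apply/ffunP => g; rewrite !ffunE; case: (eqVneq g f) => [->|_] //.
    by rewrite mulr0 [RHS]mulr0.
  rewrite (linear_scale (tpure_linear_r _)) (linear_scale (iso_inv_linear _)).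
  rewrite (linear_scale (strip_linear _)) (linear_scale (mlf_linear_l _)).
  by rewrite (linear_scale (mlf_linear_r _)).
Qed.

Lemma edge_op_mlf e m S : edge_op e (mlf m S) = edge_map e m S.
Proof. exact: (tlift_tpure (edge_map_balanced e)). Qed.
Lemma ghost_op_mlf e m S : ghost_op e (mlf m S) = ghost_map e m S.
Proof. exact: (tlift_tpure (ghost_map_balanced e)). Qed.
Lemma edge_op_linear e : linear (edge_op e).
Proof. exact: (tlift_linear (edge_map_balanced e)). Qed.
Lemma ghost_op_linear e : linear (ghost_op e).
Proof. exact: (tlift_linear (ghost_map_balanced e)). Qed.

(** Since f^* y is the scalar y_f times r(f), the sum over f in [ghost_map]
    recovers the expansion of the factor y that [absorb] pushed into L_k(F). *)
Lemma ghost_op_absorb e S z :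
  ghost_op e (absorb S z) = mlf (strip e (iso_inv sigma z)) S.
Proof.
move: z; apply: tensor_ext => [||m y].
- exact: linear_comp (ghost_op_linear e) (absorb_linear S).
- apply: linear_comp (mlf_linear_l S) _.
  exact: linear_comp (strip_linear e) (iso_inv_linear sigma).
rewrite absorb_tpure ghost_op_mlf {2}[y]edg_expand.
rewrite (linear_big (tpure_linear_r m)) (linear_big (iso_inv_linear sigma)).
rewrite (linear_big (strip_linear e)) (linear_big (mlf_linear_l S)).
apply: eq_bigr => f _; rewrite mulrA lghost_eemb -leavitt_scaleAl.
rewrite (linear_scale (mlf_linear_r _)) (linear_scale (tpure_linear_r m)).
rewrite (linear_scale (iso_inv_linear sigma)) (linear_scale (strip_linear e)).
rewrite (linear_scale (mlf_linear_l S)) -vemb_vtx -mlf_bal.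
rewrite -strip_ract -iso_inv_ract ract_tpure ract_edg_rng ffunE eqxx.
by rewrite scale1r.
Qed.

(** Apart from [fam_ee] and [fam_sum], where sigma and sigma^-1 cancel, the
    relations follow from the compatibility of sigma, sigma^-1, [absorb] and
    [strip] with the bimodule structures. *)
Lemma mlf_family : leavitt_family vert_op edge_op ghost_op.
Proof.
have lv v : linear (vert_op v) by exact: lact_linear.
split=> [//|||v u x|e|e|e|e|e e'|v|x].
- exact: edge_op_linear.
- exact: ghost_op_linear.
- by rewrite /vert_op -lactM vtxM; case: eqP => // _; rewrite lact0.
- apply: mlf_ext => [||m S]; [|exact: edge_op_linear|].
    exact: linear_comp (lv _) (edge_op_linear e).
  rewrite edge_op_mlf /edge_map /vert_op -absorb_lact -iso_lact lact_tpure.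
  by rewrite lact_vtx_edg eqxx.
- apply: mlf_ext => [||m S]; [|exact: edge_op_linear|].
    exact: linear_comp (edge_op_linear e) (lv _).
  rewrite /vert_op lact_mlf !edge_op_mlf /edge_map -tpure_bal ract_edg_rng.
  by rewrite ffunE eqxx scale1r.
- apply: mlf_ext => [||m S]; [|exact: ghost_op_linear|].
    exact: linear_comp (lv _) (ghost_op_linear e).
  rewrite ghost_op_mlf /ghost_map /vert_op (linear_big (lact_linear _)).
  by apply: eq_bigr => f _; rewrite lact_mlf lact_strip_rng.
- apply: mlf_ext => [||m S]; [|exact: ghost_op_linear|].
    exact: linear_comp (ghost_op_linear e) (lv _).
  rewrite /vert_op lact_mlf !ghost_op_mlf; apply: eq_bigr => f _.
  by rewrite -lact_tpure iso_inv_lact strip_lact_src.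
- apply: mlf_ext => [||m S].
  + exact: linear_comp (ghost_op_linear e) (edge_op_linear e').
  + by case: eqP => _ //; move=> c x y; rewrite scaler0 addr0.
  rewrite edge_op_mlf ghost_op_absorb iso_mapK strip_edg.
  case: eqP => _; first by rewrite /vert_op lact_mlf.
  exact: linear_0 (mlf_linear_l S).
- apply: mlf_ext => [||m S]; first exact: lv.
    apply: linear_pointwise_sum => e.
    exact: linear_comp (edge_op_linear e) (ghost_op_linear e).
  under eq_bigr do rewrite ghost_op_mlf (linear_big (edge_op_linear _)).
  rewrite exchange_big /vert_op lact_mlf -absorb_sum_ghost.
  apply: eq_bigr => f _; under eq_bigr do rewrite edge_op_mlf /edge_map.
  rewrite -(linear_big (absorb_linear _)) -(linear_big (iso_linear sigma)).
  by rewrite sum_edg_strip iso_lact iso_invK lact_tpure.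
- by rewrite /vert_op -(linear_big (lact_linear_l x)) -vtx_sum lact1.
Qed.

Definition mlf_act : leavitt k E -> MLF M -> MLF M :=
  leavitt_act vert_op edge_op ghost_op.

Lemma mlf_act_lmod : is_lmod mlf_act.
Proof. exact: leavitt_act_lmod mlf_family. Qed.

Lemma mlf_act_bimod : is_bimod mlf_act (ract (MLF M)).
Proof.
have [_ RM _] := bimodP (MLF M); split=> // [|a x b]; first exact: mlf_act_lmod.
rewrite /mlf_act.
apply/esym/(leavitt_intertwine (h := fun x => ract (MLF M) x b)).
- exact: mlf_act_lmod.
- exact: mlf_act_lmod.
- exact: ract_linear.
- by move=> v z; rewrite !(leavitt_act_vert mlf_family) /vert_op lact_ract.
- move=> e z; rewrite !(leavitt_act_edge mlf_family).
  move: z; apply: mlf_ext => [||m S].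
  + exact: linear_comp (ract_linear b) (edge_op_linear e).
  + exact: linear_comp (edge_op_linear e) (ract_linear b).
  by rewrite ract_mlf !edge_op_mlf /edge_map ract_absorb.
- move=> e z; rewrite !(leavitt_act_ghost mlf_family).
  move: z; apply: mlf_ext => [||m S].
  + exact: linear_comp (ract_linear b) (ghost_op_linear e).
  + exact: linear_comp (ghost_op_linear e) (ract_linear b).
  rewrite ract_mlf !ghost_op_mlf /ghost_map (linear_big (ract_linear b)).
  by apply: eq_bigr => f _; rewrite ract_mlf mulrA.
Qed.

Lemma mlf_act_vertex : vertex_relation mlf_act.
Proof.
by move=> v m S; rewrite /mlf_act (leavitt_act_vert mlf_family) /vert_op lact_mlf.
Qed.

Lemma mlf_act_edge : edge_relation sigma mlf_act.
Proof.
move=> e m S n m_ y_ sE; rewrite /mlf_act (leavitt_act_edge mlf_family).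
rewrite edge_op_mlf /edge_map sE (linear_big (absorb_linear S)).
by apply: eq_bigr => i _; rewrite absorb_tpure.
Qed.

Lemma mlf_strip_sum e n (y_ : 'I_n -> kE1 k E) (m_ : 'I_n -> M) S :
  mlf (strip e (\sum_(i < n) tpure (y_ i) (m_ i))) S =
  \sum_(i < n) mlf (lact M (ghost_mul e (y_ i)) (m_ i)) S.
Proof.
rewrite (linear_big (strip_linear e)) (linear_big (mlf_linear_l S)).
by apply: eq_bigr => i _; rewrite strip_tpure.
Qed.

Lemma mlf_act_ghost : ghost_relation sigma mlf_act.
Proof.
move=> e m S n y_ m_ sE; rewrite /mlf_act (leavitt_act_ghost mlf_family).
rewrite ghost_op_mlf; apply: eq_bigr => f _.
by rewrite sE mlf_strip_sum.
Qed.

Lemma mlf_act_ghost_edge : ghost_relation_edge sigma mlf_act.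
Proof.
move=> e m g n y_ m_ sE; rewrite /mlf_act (leavitt_act_ghost mlf_family).
rewrite ghost_op_mlf /ghost_map (bigD1 g) //= sE mlf_strip_sum ls_le eqxx.
rewrite [X in _ + X]big1 ?addr0 // => f fg; rewrite ls_le (negbTE fg).
exact: linear_0 (mlf_linear_r _).
Qed.

(** Every tensor is a finite sum of pure ones, so the hypotheses of the edge and
    ghost relations can be met for every m. *)
Lemma mlf_act_unique (act act' : leavitt k E -> MLF M -> MLF M) :
  is_lmod act -> vertex_relation act ->
  edge_relation sigma act -> ghost_relation sigma act ->
  is_lmod act' -> vertex_relation act' ->
  edge_relation sigma act' -> ghost_relation sigma act' ->
  forall a z, act' a z = act a z.
Proof.
move=> lmod av ae ag lmod' av' ae' ag'.
have [_ _ _ lin _] := lmod; have [_ _ _ lin' _] := lmod'.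
apply: (leavitt_intertwine (h := id) lmod' lmod) => [//|v|e|e];
  apply: mlf_ext (lin' _) (lin _) _ => m S.
- by rewrite av av'.
- have [n [m_ [y_ sE]]] := tensor_sum_tpure (sigma (tpure (edg k e) m)).
  by rewrite (ae _ _ _ _ _ _ sE) (ae' _ _ _ _ _ _ sE).
- have D f : exists d : {n & ('I_n -> kE1 k E) * ('I_n -> M)}%type,
      iso_inv sigma (tpure m (edg k f)) =
      \sum_(i < tag d) tpure ((tagged d).1 i) ((tagged d).2 i).
    have [n [y_ [m_ sE]]] :=
      tensor_sum_tpure (iso_inv sigma (tpure m (edg k f))).
    by exists (existT _ n (y_, m_)).
  have [d dE] := choice D.
  by rewrite (ag e m S _ _ _ dE) (ag' e m S _ _ _ dE).
Qed.

(** * The grading of M (x) L_k(F) *)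

Lemma MLF_deg_subspace n : is_subspace (@MLF_deg k E F M n).
Proof. exact: kspan_subspace. Qed.

Lemma MLF_deg_mlf n m S : leavitt_deg n S -> MLF_deg n (mlf m S).
Proof. by move=> Sn; apply: kspan_gen; exists m, S. Qed.

Lemma MLF_deg_linear (V : lmodType k) (f : MLF M -> V) (P : V -> Prop) n :
  linear f -> is_subspace P ->
  (forall m S, leavitt_deg n S -> P (f (mlf m S))) ->
  forall z, MLF_deg n z -> P (f z).
Proof.
move=> lf sP Pf; apply: kspan_min; first exact: preim_subspace lf _ sP.
by move=> _ [m [S [Sn ->]]]; exact: Pf.
Qed.

Lemma absorb_deg n S z : leavitt_deg n S -> MLF_deg (n + 1) (absorb S z).
Proof.
move=> Sn; have [N [m_ [y_ ->]]] := tensor_sum_tpure z.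
rewrite (linear_big (absorb_linear S)); apply: subspace_sum => [|i _].
  exact: MLF_deg_subspace.
rewrite absorb_tpure; apply: MLF_deg_mlf; rewrite /eemb mulr_suml.
apply: subspace_sum => [|f _]; first exact: leavitt_deg_subspace.
rewrite -leavitt_scaleAl.
exact: (subspace_scale (k := k) _ (leavitt_deg_subspace k F _)
  (leavitt_deg_ledge f Sn)).
Qed.

(** Balanced because the projections of L_k(F) commute with kF^0. *)
Definition mlf_proj (n : int) : MLF M -> MLF M :=
  @tlift _ _ _ _ M (leavitt_bimod k F) _ (fun m S => mlf m (leavitt_proj n S)).

Lemma mlf_proj_balanced n : @balanced _ _ _ _ M (leavitt_bimod k F) _
  (fun m S => mlf m (leavitt_proj n S)).
Proof.
split=> [S|m|m b S]; first exact: mlf_linear_l.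
  exact: linear_comp (mlf_linear_r m) (leavitt_proj_linear n).
by rewrite mlf_bal -leavitt_proj_vemb.
Qed.

Lemma mlf_proj_linear n : linear (mlf_proj n).
Proof. exact: (tlift_linear (mlf_proj_balanced n)). Qed.

Lemma mlf_proj_deg d n z :
  MLF_deg d z -> mlf_proj n z = if n == d then z else 0.
Proof.
pose P z := mlf_proj n z = if n == d then z else 0.
apply: (MLF_deg_linear (f := id) (P := P)) => // [|m S Sd].
  split=> [|c x y Px Py]; rewrite /P.
    by rewrite (linear_0 (mlf_proj_linear n)) if_same.
  rewrite mlf_proj_linear Px Py; case: eqP => // _.
  by rewrite scaler0 addr0.
rewrite /P [LHS](tlift_tpure (mlf_proj_balanced n)) (leavitt_proj_deg _ Sd).
by case: eqP => // _; exact: linear_0 (mlf_linear_r m).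
Qed.

Lemma MLF_deg_span z : kspan (fun y => exists n, @MLF_deg k E F M n y) z.
Proof.
have [N [m_ [S_ ->]]] := @tensor_sum_tpure _ _ _ _ M (leavitt_bimod k F) z.
pose Q := kspan (fun y => exists n, @MLF_deg k E F M n y).
have sQ : is_subspace Q by exact: kspan_subspace.
apply: (subspace_sum _ sQ) => i _.
apply: (kspan_min (Q := fun S => Q (mlf (m_ i) S)) _ _ (leavitt_deg_span (S_ i))).
  exact: preim_subspace (mlf_linear_r (m_ i)) _ sQ.
by move=> S [n Sn]; apply: kspan_gen; exists n; exact: MLF_deg_mlf.
Qed.

Lemma mlf_act_graded :
  is_graded_bimod (@leavitt_deg k E) (@leavitt_deg k F)
    mlf_act (ract (MLF M)) (@MLF_deg k E F M).
Proof.
split.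
- exact: MLF_deg_subspace.
- apply: (direct_sum_proj (p := mlf_proj)).
  + exact: MLF_deg_subspace.
  + exact: mlf_proj_linear.
  + by move=> d n z; exact: mlf_proj_deg.
  + exact: MLF_deg_span.
- move=> d n a z; rewrite /mlf_act.
  apply: (leavitt_graded_action mlf_act_lmod MLF_deg_subspace).
  + move=> v {}n {}z; rewrite /mlf_act (leavitt_act_vert mlf_family).
    apply: MLF_deg_linear (lact_linear _) (MLF_deg_subspace n) _ z => m S Sn.
    by rewrite /vert_op lact_mlf; exact: MLF_deg_mlf.
  + move=> e {}n {}z; rewrite /mlf_act (leavitt_act_edge mlf_family).
    apply: MLF_deg_linear (edge_op_linear e) (MLF_deg_subspace _) _ z => m S Sn.
    by rewrite edge_op_mlf; exact: absorb_deg.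
  + move=> e {}n {}z; rewrite /mlf_act (leavitt_act_ghost mlf_family).
    apply: MLF_deg_linear (ghost_op_linear e) (MLF_deg_subspace _) _ z => m S Sn.
    rewrite ghost_op_mlf; apply: subspace_sum => [|f _].
      exact: MLF_deg_subspace.
    exact/MLF_deg_mlf/leavitt_deg_lghost.
- move=> d n T z Td.
  apply: MLF_deg_linear (ract_linear T) (MLF_deg_subspace _) _ z => m S Sn.
  by rewrite ract_mlf; apply/MLF_deg_mlf/leavitt_degM.
Qed.
End Operators.

Theorem theorem4p11 (k : fieldType) (E F : graph)
    (nsE : no_sinks E) (nsF : no_sinks F)
    (M : bimod (kE0 k E) (kE0 k F))
    (sigma : bimod_iso (tensor (kE1 k E) M) (tensor M (kE1 k F))) :
  exists act : leavitt k E -> MLF M -> MLF M,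
    [/\ is_bimod act (ract (MLF M)),
        [/\ vertex_relation act, edge_relation sigma act,
            ghost_relation sigma act & ghost_relation_edge sigma act],
        forall act' : leavitt k E -> MLF M -> MLF M,
          is_bimod act' (ract (MLF M)) ->
          vertex_relation act' -> edge_relation sigma act' ->
          ghost_relation sigma act' ->
          forall a z, act' a z = act a z &
        is_graded_bimod (@leavitt_deg k E) (@leavitt_deg k F)
          act (ract (MLF M)) (@MLF_deg k E F M)].
Proof.
exists (mlf_act sigma); split.
- exact: mlf_act_bimod.
- split; [exact: mlf_act_vertex|exact: mlf_act_edge|exact: mlf_act_ghost|].
  exact: mlf_act_ghost_edge.
- move=> act' [lmod' _ _] av' ae' ag'.
  apply: (mlf_act_unique (mlf_act_lmod sigma) _ _ _ lmod' av' ae' ag').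
  + exact: mlf_act_vertex.
  + exact: mlf_act_edge.
  + exact: mlf_act_ghost.
- exact: mlf_act_graded.
Qed.
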